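(* Let $(p_n)_{n\ge 1}$ be a sequence in $(0,1)$ satisfying $0<\liminf_{n\to\infty}p_n\le\limsup_{n\to\infty}p_n<1$, let $\mathcal{N}=\{n_1<n_2<\dots\}$ be an infinite subset of $\{1,2,\dots\}$, and let $(f_n)_{n\in\mathcal{N}}$, $f_n\colon\{0,1\}^n\to\{0,1\}$, be a non-degenerate sequence of regular and increasing Boolean functions. Then $(f_n)_{n\in\mathcal{N}}$ is not tame.
   Context: Write $[n]=\{1,\dots,n\}$. For each $n\ge 1$, $X^{(n)}=(X^{(n)}_t)_{t\ge 0}$ is the continuous-time $p_n$-biased random walk on $\{0,1\}^n$: the coordinates $(X^{(n)}_t(i))_{t\ge0}$, $i\in[n]$, are independent, and each coordinate is, at the times of its own rate one Poisson process, assigned a new value drawn from $(1-p_n)\delta_0+p_n\delta_1$ independently of everything else. The initial state $X^{(n)}_0$ is distributed according to the stationary measure $\pi_n=((1-p_n)\delta_0+p_n\delta_1)^{\otimes n}$. For $f\colon\{0,1\}^n\to\{0,1\}$ (a Boolean function), $C_f$ is the random number of times in $(0,1)$ at which $(f(X^{(n)}_t))_{t\ge0}$ changes its value, i.e. $C_f=\lim_{N\to\infty}\sum_{i=0}^{N-1}\mathbf{1}\bigl(f(X^{(n)}_{i/N})\ne f(X^{(n)}_{(i+1)/N})\bigr)$. All limits, liminf and limsup of quantities indexed by $n\in\mathcal{N}$ are taken along $n\in\mathcal{N}$. The sequence $(f_n)_{n\in\mathcal{N}}$ is tame if $(C_{f_n})$ is tight: for every $\varepsilon>0$ there are $k\ge1$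 and $n_0\ge1$ such that $P(C_{f_n}\ge k)<\varepsilon$ for all $n\in\mathcal{N}$ with $n\ge n_0$. The sequence is non-degenerate if $0<\liminf_{n\to\infty}P(f_n(X_0^{(n)})=1)\le\limsup_{n\to\infty}P(f_n(X_0^{(n)})=1)<1$. $f\colon\{0,1\}^n\to\{0,1\}$ is increasing if $f(x)\le f(x')$ whenever $x(i)\le x'(i)$ for all $i\in[n]$. The influence of bit $i$ on $f$ is $I_i(f)=P\bigl(f(X_0^{(n)})\ne f(R_iX_0^{(n)})\bigr)$, where $R_ix$ is obtained from $x$ by resampling the $i$th bit (independently) according to $(1-p_n)\delta_0+p_n\delta_1$. $f$ is regular if $I_i(f)$ is the same for all $i\in[n]$. *)

(* Defs.v *)
From HB Require Import structures.
From mathcomp Require Import all_boot all_order all_algebra.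
From mathcomp Require Import all_classical all_reals all_analysis.

Set Implicit Arguments.
Unset Strict Implicit.
Unset Printing Implicit Defensive.

Import Order.TTheory GRing.Theory Num.Theory.
Import numFieldNormedType.Exports.

Local Open Scope classical_set_scope.
Local Open Scope ring_scope.

Notation cube n := {ffun 'I_n -> bool}.
Notation boolean_function n := (cube n -> bool).

Definition mutually_independent (R : realType) (d : measure_display)
    (T : measurableType d) (P : probability T R) (I : eqType)
    (F : I -> set (set T)) : Prop :=
  forall (s : seq I) (A : I -> set T), uniq s ->
    (forall i, i \in s -> F i (A i)) ->
    P (\bigcap_(i in [set` s]) A i) = (\prod_(i <- s) P (A i))%E.

Definition sigma_process (R : realType) (d d' : measure_display)
    (T : measurableType d) (T' : measurableType d') (Y : R -> T -> T') :
    set (set T) :=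
  <<s \bigcup_(t in [set t : R | 0 <= t]) g_sigma_algebra_preimage (Y t) >>.

(* Counting-process form: K t is the number of rings of the clock in (0, t].
   Path monotonicity makes the truncated subtraction on nat harmless. *)
Definition poisson_process_rate1 (R : realType) (d : measure_display)
    (T : measurableType d) (P : probability T R) (K : R -> T -> nat) : Prop :=
  [/\ forall t : R, 0 <= t -> measurable_fun setT (K t),
      forall w, K 0 w = 0%N,
      forall w, (forall s t : R, 0 <= s -> s <= t -> (K s w <= K t w)%N) /\
        (forall t : R, 0 <= t -> \forall s \near t^'+, K s w = K t w),
      forall (m : nat) (t : nat -> R), 0 <= t 0%N ->
        (forall j, t j <= t j.+1) ->
        mutually_independent P (fun j : 'I_m =>
          g_sigma_algebra_preimage (fun w => (K (t j.+1) w - K (t j) w)%N)) &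
      forall s t : R, 0 <= s -> s < t -> forall k : nat,
        P [set w | (K t w - K s w)%N = k] = (poisson_pmf (t - s) k)%:E].

(* K i is the Poisson clock of coordinate i, V i 0 its initial value and
   V i k, for k > 0, the value drawn at the k-th ring of that clock. *)
Definition biased_random_walk (R : realType) (d : measure_display)
    (T : measurableType d) (P : probability T R) (p : R) (n : nat)
    (X : R -> T -> cube n) : Prop :=
  exists (K : 'I_n -> R -> T -> nat) (V : 'I_n -> nat -> T -> bool),
  [/\ forall i, poisson_process_rate1 P (K i),
      forall i k, measurable_fun setT (V i k) /\
        (forall B : set bool, P (V i k @^-1` B) = bernoulli_prob p B),
      mutually_independent P (fun j : 'I_n + 'I_n * nat =>
        match j with
        | inl i => sigma_process (K i)
        | inr ik => g_sigma_algebra_preimage (V ik.1 ik.2)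
        end) &
      forall t : R, 0 <= t -> forall w i, X t w i = V i (K i t w) w].

(* For a biased random walk the limit exists along every path, since each
   clock rings finitely often before time 1. *)
Definition num_changes (R : realType) (T : Type) (n : nat)
    (X : R -> T -> cube n) (f : boolean_function n) (w : T) : \bar R :=
  limn (fun M : nat =>
    ((\sum_(i < M) (f (X (i%:R / M%:R) w) != f (X (i.+1%:R / M%:R) w)))%N%:R
      : R)%:E).

Definition tame (R : realType) (d : nat -> measure_display)
    (T : forall n, measurableType (d n)) (P : forall n, probability (T n) R)
    (X : forall n, R -> T n -> cube n) (NN : set nat)
    (f : forall n, boolean_function n) : Prop :=
  forall eps : R, 0 < eps ->
    exists k n0 : nat, [/\ (1 <= k)%N, (1 <= n0)%N &
      forall n, NN n -> (n0 <= n)%N ->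
        (P n [set w | (k%:R)%:E <= num_changes (X n) (f n) w] < eps%:E)%E].

Definition non_degenerate (R : realType) (d : nat -> measure_display)
    (T : forall n, measurableType (d n)) (P : forall n, probability (T n) R)
    (X : forall n, R -> T n -> cube n) (NN : set nat)
    (f : forall n, boolean_function n) : Prop :=
  let u n := P n [set w | f n (X n 0 w) = true] in
  [/\ (0 < limf_einf u (within NN \oo))%E,
      (limf_einf u (within NN \oo) <= limf_esup u (within NN \oo))%E &
      (limf_esup u (within NN \oo) < 1)%E].

Definition increasing_bf (n : nat) (f : boolean_function n) : Prop :=
  forall x x' : cube n, (forall i, (x i <= x' i)%N) -> (f x <= f x')%N.

Definition set_bit (n : nat) (i : 'I_n) (b : bool) (x : cube n) : cube n :=
  [ffun j => if j == i then b else x j].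

(* The second factor of the product space carries the resampled bit. *)
Definition influence (R : realType) (d : measure_display)
    (T : measurableType d) (P : probability T R) (p : R) (n : nat)
    (X : R -> T -> cube n) (f : boolean_function n) (i : 'I_n) : \bar R :=
  (P \x bernoulli_prob p)%E
    [set z : T * bool | f (X 0 z.1) <> f (set_bit i z.2 (X 0 z.1))].

Definition regular_bf (R : realType) (d : measure_display)
    (T : measurableType d) (P : probability T R) (p : R) (n : nat)
    (X : R -> T -> cube n) (f : boolean_function n) : Prop :=
  forall i j : 'I_n, influence P p X f i = influence P p X f j.

(* Main.v *)
Require Import Defs.
From mathcomp Require Import all_boot all_order all_algebra.
From mathcomp Require Import all_classical all_reals all_analysis.
From mathcomp Require Import ring lra zify.
Set Implicit Arguments.
Unset Strict Implicit.
Unset Printing Implicit Defensive.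
Import Order.TTheory GRing.Theory Num.Theory.
Import numFieldNormedType.Exports.
Local Open Scope classical_set_scope.
Local Open Scope ring_scope.

(** Let [T_rho] be the noise operator, which keeps each bit with probability [rho]
    and redraws it otherwise.  Observed at the times [j / N], the walk is the
    reversible Markov chain with kernel [T_rho], [rho = exp (- 1 / N)]
    ([probability_grid_path]), and the number of changes is the largest number of
    changes seen on a grid ([num_changes_max]).  Suppose that it is tight.

    A quiet scale.  Off an event of small probability at most [k] changes are seen
    on every grid.  Along nested grids, each refinement that reveals a new change
    uses up one of them, so among many successive refinements one, from a coarse
    grid to a fine one, hardly ever reveals anything
    ([exists_quiet_refinement]).  Then, on the fine grid, the function hardly ever
    changes and is back at its former value after a lag of a quarter of the coarse
    step ([return_le_refines]).

    Forecasts.  Let [u] be the conditional probability, given the present state,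
    that the function is 1 after this lag.  When a change occurs and [u] is not
    within 1/3 of the new value, the function is back after the lag with
    conditional probability at least 1/3; by the Markov property at the first such
    time, such changes hardly ever occur ([surprising_le_return]).  By
    reversibility the same holds in reversed time.  So the forecast made just after
    a change is close to the new value, and the one made just before it, with one
    more step of lag, is close to the old value: in a single step of the fine grid
    [u] departs by at least 1/3 from its conditional mean ([change_le_jumps]).

    Forecasts do not jump.  The fourth moment of the innovation of [u] in one of
    the [N] steps is at most [9 * (K / N) ^ 2] plus [2 / N] times the sum over the
    bits of the fourth moments of the derivatives of [u], where [K] bounds the
    squared gradient of [u] at every point ([gradient_bound],
    [expect_fourth_moment_noise]).  The first term is negligible after [N] steps
    if the fine grid is fine enough.  For the second, regularity enters: by
    Bessel's inequality the common influence is of order at most [n ^ (- 1 / 2)]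
    ([regular_small_derivative]), so that the sets where a derivative is not small
    after half of the noise are themselves small, and by hypercontractivity small
    sets are left by the other half ([small_set_expansion],
    [sum_derivative_fourth_moment]).

    Hence the function hardly ever changes at all, while by the spectral gap its
    values at two times at distance at least 1/4 differ with a probability
    proportional to its variance, which non-degeneracy bounds below
    ([spectral_gap], [expect_diff_ge]). *)

(** * The noise operator on the biased cube *)

Section NoiseOperator.
Variables (R : realFieldType) (n : nat) (p : R).
Implicit Types (r s : 'I_n -> R) (g h : cube n -> R) (x y z : cube n)
  (i j : 'I_n) (a b : bool) (l : seq 'I_n) (rho : R).

Definition bit_weight b : R := if b then p else 1 - p.

(** The bit is kept with probability [rho] and otherwise redrawn. *)
Definition bit_kernel (rho : R) a b : R :=
  rho * (a == b)%:R + (1 - rho) * bit_weight b.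

(** A separate rate for each bit lets one apply the noise bit by bit. *)
Definition kernel r x y : R := \prod_i bit_kernel (r i) (x i) (y i).

Definition noise r g x : R := \sum_y kernel r x y * g y.

Definition expect g : R :=
  \sum_(x : cube n) (\prod_i bit_weight (x i)) * g x.

Definition on l rho : 'I_n -> R := fun j => if j \in l then rho else 1.

Definition discrete_derivative i g x : R :=
  g (set_bit i true x) - g (set_bit i false x).

Definition indep_of_bit i g := forall b x, g (set_bit i b x) = g x.

Local Notation T := noise.
Local Notation E := expect.
Local Notation D := discrete_derivative.

Lemma bit_kernel_comp rho sigma a c :
  \sum_b bit_kernel rho a b * bit_kernel sigma b c =
  bit_kernel (rho * sigma) a c.
Proof.
rewrite big_bool /bit_kernel /bit_weight.
by case: a; case: c => /=; ring.
Qed.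

Lemma sum_bit_kernel rho a : \sum_b bit_kernel rho a b = 1.
Proof.
by rewrite big_bool /bit_kernel /bit_weight; case: a => /=; ring.
Qed.

Lemma bit_kernel1 a b : bit_kernel 1 a b = (a == b)%:R.
Proof. by rewrite /bit_kernel subrr mul0r addr0 mul1r. Qed.

Lemma bit_kernel0 a b : bit_kernel 0 a b = bit_weight b.
Proof. by rewrite /bit_kernel mul0r add0r subr0 mul1r. Qed.

Lemma eq_noise r s g h x : (forall j, r j = s j) -> (forall y, g y = h y) ->
  T r g x = T s h x.
Proof.
move=> rs gh; apply: eq_bigr => y _; rewrite gh; congr (_ * _).
by apply: eq_bigr => j _; rewrite rs.
Qed.

Lemma eq_expect g h : (forall y, g y = h y) -> E g = E h.
Proof. by move=> gh; apply: eq_bigr => y _; rewrite gh. Qed.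

Lemma noise_comp r s g x : T r (T s g) x = T (fun j => r j * s j) g x.
Proof.
rewrite /noise.
transitivity (\sum_y \sum_z kernel r x y * kernel s y z * g z).
  apply: eq_bigr => y _; rewrite big_distrr /=.
  by apply: eq_bigr => z _; rewrite mulrA.
rewrite exchange_big /=; apply: eq_bigr => z _; rewrite -big_distrl /=; congr (_ * _).
rewrite /kernel; under eq_bigr => y _ do rewrite -big_split.
rewrite -(bigA_distr_bigA (fun i b => bit_kernel (r i) (x i) b * bit_kernel (s i) b (z i))).
by apply: eq_bigr => i _; rewrite bit_kernel_comp.
Qed.

Lemma sum_kernel r x : \sum_y kernel r x y = 1.
Proof.
rewrite /kernel -(bigA_distr_bigA (fun i b => bit_kernel (r i) (x i) b)).
by rewrite big1 // => i _; rewrite sum_bit_kernel.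
Qed.

Lemma noise_cst r c x : T r (fun=> c) x = c.
Proof. by rewrite /noise -big_distrl /= sum_kernel mul1r. Qed.

Lemma noiseD r g h x : T r (fun y => g y + h y) x = T r g x + T r h x.
Proof. by rewrite /noise -big_split; apply: eq_bigr => y _; rewrite mulrDr. Qed.

Lemma noiseZ r c g x : T r (fun y => c * g y) x = c * T r g x.
Proof. by rewrite /noise big_distrr; apply: eq_bigr => y _ /=; rewrite mulrCA. Qed.

Lemma noiseB r g h x : T r (fun y => g y - h y) x = T r g x - T r h x.
Proof.
rewrite -[- T r h x]mulN1r -noiseZ -noiseD.
by apply: eq_noise => // y; rewrite mulN1r.
Qed.

Lemma noise_sum (I : Type) (t : seq I) r (G : I -> cube n -> R) x :
  T r (fun y => \sum_(i <- t) G i y) x = \sum_(i <- t) T r (G i) x.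
Proof.
rewrite /noise exchange_big /=; apply: eq_bigr => y _.
by rewrite big_distrr.
Qed.

Lemma expect_noise0 g x : T (fun=> 0) g x = E g.
Proof.
apply: eq_bigr => y _; congr (_ * _); apply: eq_bigr => j _.
exact: bit_kernel0.
Qed.

Lemma kernel_id x y : kernel (fun=> 1) x y = (x == y)%:R.
Proof.
rewrite /kernel; case: eqP => [->|/eqP xy].
  by apply: big1 => j _; rewrite bit_kernel1 eqxx.
have [j xyj] : exists j, x j != y j.
  apply/existsP; rewrite -negb_forall; apply: contra xy => /forallP xy.
  by apply/eqP/ffunP => j; apply/eqP.
by rewrite (bigD1 j) //= bit_kernel1 (negPf xyj) mul0r.
Qed.

Lemma noise_id g x : T (fun=> 1) g x = g x.
Proof.
rewrite /noise (bigD1 x) //= kernel_id eqxx mul1r big1 ?addr0 // => y.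
by rewrite kernel_id eq_sym => /negPf ->; rewrite mul0r.
Qed.

(** At rate 1 a bit is never redrawn, so a factor that reads only this bit can
    be pulled out. *)
Lemma noise_fixed_bit r i (F : bool -> R) g x : r i = 1 ->
  T r (fun y => F (y i) * g y) x = F (x i) * T r g x.
Proof.
move=> ri; rewrite /noise big_distrr; apply: eq_bigr => y _ /=.
have [<-|xy] := eqVneq (x i) (y i); first by rewrite mulrCA.
suff -> : kernel r x y = 0 by rewrite !mul0r mulr0.
by rewrite /kernel (bigD1 i) //= ri bit_kernel1 (negPf xy) mul0r.
Qed.

Lemma set_bit_same i b x : set_bit i b x i = b.
Proof. by rewrite ffunE eqxx. Qed.

Lemma set_bit_other i j b x : j != i -> set_bit i b x j = x j.
Proof. by rewrite ffunE => /negPf ->. Qed.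

Lemma set_bit_set i a b x : set_bit i a (set_bit i b x) = set_bit i a x.
Proof. by apply/ffunP => j; rewrite !ffunE; case: eqP. Qed.

Lemma set_bit_id i x : set_bit i (x i) x = x.
Proof. by apply/ffunP => j; rewrite !ffunE; case: eqP => [->|]. Qed.

Lemma noise_one i rho g x :
  T (on [:: i] rho) g x =
  bit_kernel rho (x i) true * g (set_bit i true x) +
  bit_kernel rho (x i) false * g (set_bit i false x).
Proof.
have E1 b : kernel (on [:: i] rho) x (set_bit i b x) = bit_kernel rho (x i) b.
  rewrite /kernel (bigD1 i) //= big1 ?mulr1; first by rewrite /on inE eqxx ffunE eqxx.
  move=> j ji; rewrite /on inE (negPf ji) bit_kernel1 set_bit_other //.
  by rewrite eqxx.
have tf : set_bit i false x != set_bit i true x.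
  by apply/eqP => /ffunP/(_ i); rewrite !ffunE eqxx.
rewrite /noise (bigD1 (set_bit i true x)) //= E1.
rewrite (bigD1 (set_bit i false x)) //= E1 big1 ?addr0 // => y /andP[y1 y0].
suff -> : kernel (on [:: i] rho) x y = 0 by rewrite mul0r.
have [j /andP[ji xyj]] : exists j, (j != i) && (x j != y j).
  apply/existsP; rewrite -[X in is_true X]negbK negb_exists.
  apply/negP => /forallP H.
  have yx : y = set_bit i (y i) x.
    apply/ffunP => j; rewrite ffunE; have [->//|ji] := eqVneq j i.
    by have := H j; rewrite ji /= negbK => /eqP.
  by move: y1 y0; rewrite yx; case: (y i); rewrite eqxx.
by rewrite /kernel (bigD1 j) //= /on inE (negPf ji) bit_kernel1 (negPf xyj) mul0r.
Qed.

Lemma noise_cons i l rho g x : i \notin l ->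
  T (on (i :: l) rho) g x = T (on l rho) (T (on [:: i] rho) g) x.
Proof.
move=> il; rewrite noise_comp; apply: eq_noise => // j.
rewrite /on !inE; have [->|_] := eqVneq j i; first by rewrite (negPf il) mul1r.
by rewrite /= mulr1.
Qed.

Lemma noise_comm r s g x : T r (T s g) x = T s (T r g) x.
Proof. by rewrite !noise_comp; apply: eq_noise => // j; rewrite mulrC. Qed.

Lemma noise_one_indep i rho g x : indep_of_bit i g ->
  T (on [:: i] rho) g x = g x.
Proof.
move=> gi; rewrite noise_one !gi -mulrDl.
by rewrite -[RHS]mul1r -(sum_bit_kernel rho (x i)) big_bool.
Qed.

(** A function that does not depend on bit [i] equals its own average over that
    bit, and the averaging erases whatever rate was used there. *)
Lemma noise_indep_rate r s i g x : indep_of_bit i g ->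
  (forall j, j != i -> r j = s j) -> T r g x = T s g x.
Proof.
move=> gi rs.
have gE y : g y = T (on [:: i] 0) g y by rewrite noise_one_indep.
rewrite (eq_noise x (fun=> erefl) gE) [RHS](eq_noise x (fun=> erefl) gE).
rewrite !noise_comp; apply: eq_noise => // j; rewrite /on inE.
by case: eqVneq => [_|/rs ->//]; rewrite !mulr0.
Qed.

Lemma noise_indep r i g : indep_of_bit i g -> indep_of_bit i (T r g).
Proof.
move=> gi b x; pose s j := if j == i then 0 else r j.
have rs j : j != i -> r j = s j by rewrite /s => /negPf ->.
rewrite !(noise_indep_rate _ gi rs); apply: eq_bigr => y _; congr (_ * _).
apply: eq_bigr => j _; have [->|ji] := eqVneq j i; last by rewrite set_bit_other.
by rewrite /s eqxx !bit_kernel0.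
Qed.

Lemma set_bit_indep i b g : indep_of_bit i (fun x => g (set_bit i b x)).
Proof. by move=> a x; rewrite set_bit_set. Qed.

Lemma derivative_indep i g : indep_of_bit i (D i g).
Proof. by move=> a x; rewrite /D !set_bit_set. Qed.

Lemma noise_set_bit r i b g x : r i = 1 ->
  T r g (set_bit i b x) = T r (fun y => g (set_bit i b y)) x.
Proof.
move=> ri.
have := noise_fixed_bit (fun a => (a == b)%:R) g (set_bit i b x) ri.
rewrite set_bit_same eqxx mul1r => <-.
have E1 y : (y i == b)%:R * g y = (y i == b)%:R * g (set_bit i b y).
  by case: eqP => [<-|]; rewrite ?set_bit_id // !mul0r.
rewrite (eq_noise _ (fun=> erefl) E1).
rewrite (noise_fixed_bit (fun a => (a == b)%:R)) // set_bit_same eqxx mul1r.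
exact/noise_indep/set_bit_indep.
Qed.

Lemma derivative_noise1 r i g x : r i = 1 -> D i (T r g) x = T r (D i g) x.
Proof. by move=> ri; rewrite /D !noise_set_bit // -noiseB. Qed.

Lemma derivative_noise_one i rho g x :
  D i (T (on [:: i] rho) g) x = rho * D i g x.
Proof.
by rewrite /D !noise_one !set_bit_same !set_bit_set /bit_kernel /=; ring.
Qed.

Lemma derivative_noise r i g x : D i (T r g) x = r i * T r (D i g) x.
Proof.
pose s j := if j == i then 1 else r j.
have si : s i = 1 by rewrite /s eqxx.
have E1 y : T r g y = T s (T (on [:: i] (r i)) g) y.
  rewrite noise_comp; apply: eq_noise => // j; rewrite /s /on inE.
  by case: eqP => [->|]; rewrite ?mul1r ?mulr1.
rewrite {1}/D !E1 -/(D i _ x) derivative_noise1 //.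
rewrite (eq_noise x (fun=> erefl) (derivative_noise_one i (r i) g)) noiseZ.
congr (_ * _); apply: noise_indep_rate (derivative_indep i g) _ => j.
by rewrite /s => /negPf ->.
Qed.

End NoiseOperator.
(** * Variance under noise and the spectral gap *)

Section Contraction.
Variables (R : realFieldType) (n : nat) (p lam : R).
Hypothesis lam_gt0 : 0 < lam.
Hypothesis p_lam : lam <= p <= 1 - lam.
Implicit Types (r s : 'I_n -> R) (g h u : cube n -> R) (x y z : cube n)
  (i j : 'I_n) (a b : bool) (l : seq 'I_n) (rho : R).

Local Notation T := (noise p).
Local Notation E := (expect p).
Local Notation D := discrete_derivative.

Definition rates r := forall j, 0 <= r j <= 1.

Lemma rates_on l rho : 0 <= rho <= 1 -> rates (on l rho).
Proof. by move=> r01 j; rewrite /on; case: ifP => // _; rewrite ler01 lexx. Qed.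

Lemma rates_cst rho : 0 <= rho <= 1 -> rates (fun=> rho).
Proof. by move=> r01 j. Qed.

Lemma bit_weight_ge b : lam <= bit_weight p b.
Proof. by case/andP: p_lam => ? ?; case: b => /=; lra. Qed.

Lemma bit_kernel_ge0 rho a b : 0 <= rho <= 1 -> 0 <= bit_kernel p rho a b.
Proof.
move=> /andP[r0 r1]; rewrite addr_ge0 ?mulr_ge0 ?subr_ge0 ?ler0n //.
by rewrite (le_trans _ (bit_weight_ge b)) ?ltW.
Qed.

Lemma kernel_ge0 r x y : rates r -> 0 <= kernel p r x y.
Proof. by move=> r01; apply: prodr_ge0 => j _; exact: bit_kernel_ge0. Qed.

Lemma noise_le r g h x : rates r -> (forall y, g y <= h y) -> T r g x <= T r h x.
Proof. by move=> r01 gh; apply: ler_sum => y _; rewrite ler_wpM2l ?kernel_ge0. Qed.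

Lemma noise_ge0 r g x : rates r -> (forall y, 0 <= g y) -> 0 <= T r g x.
Proof. by move=> r01 g0; rewrite -(noise_cst p r 0 x); exact: noise_le. Qed.

Lemma noise_sqr_center r g c x :
  T r (fun y => (g y - c) ^+ 2) x =
  T r (fun y => g y ^+ 2) x - 2 * c * T r g x + c ^+ 2.
Proof.
rewrite -[in RHS](noise_cst p r (c ^+ 2) x) -noiseZ -noiseB -noiseD.
by apply: eq_noise => // y; ring.
Qed.

Lemma noise_sqr r g x : rates r -> (T r g x) ^+ 2 <= T r (fun y => g y ^+ 2) x.
Proof.
move=> r01; rewrite -subr_ge0.
have := @noise_ge0 r (fun y => (g y - T r g x) ^+ 2) x r01 (fun y => sqr_ge0 _).
by rewrite noise_sqr_center; lra.
Qed.

Lemma noise_norm r g x : rates r -> `|T r g x| <= T r (fun y => `|g y|) x.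
Proof.
move=> r01; apply: le_trans (ler_norm_sum _ _ _) _; apply: ler_sum => y _.
by rewrite normrM ger0_norm // kernel_ge0.
Qed.

Lemma rates0 : rates (fun=> 0).
Proof. by move=> j; rewrite lexx ler01. Qed.

Let x0 : cube n := [ffun=> true].

Lemma le_expect g h : (forall y, g y <= h y) -> E g <= E h.
Proof.
by move=> gh; rewrite -!(expect_noise0 p _ x0); apply: noise_le rates0 gh.
Qed.

Lemma expect_ge0 g : (forall y, 0 <= g y) -> 0 <= E g.
Proof. by move=> g0; rewrite -(expect_noise0 p _ x0); apply: noise_ge0 rates0 g0. Qed.

Lemma expect_cst (c : R) : E (fun _ : cube n => c) = c.
Proof. by rewrite -(expect_noise0 p _ x0) noise_cst. Qed.

Lemma expectD g h : E (fun y => g y + h y) = E g + E h.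
Proof. by rewrite -!(expect_noise0 p _ x0) noiseD. Qed.

Lemma expectB g h : E (fun y => g y - h y) = E g - E h.
Proof. by rewrite -!(expect_noise0 p _ x0) noiseB. Qed.

Lemma expectZ c g : E (fun y => c * g y) = c * E g.
Proof. by rewrite -!(expect_noise0 p _ x0) noiseZ. Qed.

Lemma expect_sum (I : Type) (t : seq I) (G : I -> cube n -> R) :
  E (fun y => \sum_(i <- t) G i y) = \sum_(i <- t) E (G i).
Proof.
rewrite -(expect_noise0 p _ x0) noise_sum.
by apply: eq_bigr => j _; rewrite expect_noise0.
Qed.

Lemma expect_noise r g : E (T r g) = E g.
Proof.
rewrite -!(expect_noise0 p _ x0) noise_comp.
by apply: eq_noise => // j; rewrite mul0r.
Qed.

Lemma expect_noise_sqr r g : rates r ->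
  E (fun x => T r g x ^+ 2) <= E (fun x => g x ^+ 2).
Proof.
move=> r01; rewrite -[leRHS](expect_noise r).
by apply: le_expect => y; exact: noise_sqr.
Qed.

Lemma bit_reversible rho a b :
  bit_weight p a * bit_kernel p rho a b = bit_weight p b * bit_kernel p rho b a.
Proof. by rewrite /bit_kernel /bit_weight; case: a; case: b => /=; ring. Qed.

Lemma kernel_reversible r x y :
  (\prod_i bit_weight p (x i)) * kernel p r x y =
  (\prod_i bit_weight p (y i)) * kernel p r y x.
Proof.
by rewrite /kernel -!big_split; apply: eq_bigr => j _; exact: bit_reversible.
Qed.

Lemma expect_noise_sym r g h :
  E (fun x => g x * T r h x) = E (fun x => T r g x * h x).
Proof.
rewrite /expect /noise.
transitivity (\sum_(x : cube n) \sum_(y : cube n) (\prod_i bit_weight p (x i)) * kernel p r x y * (g x * h y)).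
  apply: eq_bigr => x _; rewrite !big_distrr; apply: eq_bigr => y _ /=; ring.
rewrite exchange_big; apply: eq_bigr => y _ /=.
rewrite big_distrl big_distrr; apply: eq_bigr => x _ /=.
by rewrite kernel_reversible; ring.
Qed.

(** The variance of [g] under the law of the noised point started from [x]. *)
Definition variance r g x := T r (fun y => g y ^+ 2) x - T r g x ^+ 2.

Lemma variance_one i rho g x :
  variance (on [:: i] rho) g x =
  bit_kernel p rho (x i) true * bit_kernel p rho (x i) false * D i g x ^+ 2.
Proof.
rewrite /variance !noise_one /D.
have -> : bit_kernel p rho (x i) false = 1 - bit_kernel p rho (x i) true.
  by have := sum_bit_kernel p rho (x i); rewrite big_bool /=; lra.
ring.
Qed.

Lemma bit_kernel_spread rho a : 0 <= rho <= 1 ->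
  (1 - rho) * lam ^+ 2 <=
  bit_kernel p rho a true * bit_kernel p rho a false <= 1 - rho.
Proof.
move=> /andP[r0 r1]; case/andP: p_lam => p1 p2.
have H c d : lam <= c -> c <= 1 -> lam <= d -> d <= 1 ->
    (1 - rho) * lam ^+ 2 <= ((1 - rho) * c) * d <= 1 - rho.
  move=> c1 c2 d1 d2; have r0' : 0 <= 1 - rho by lra.
  have cd1 : lam ^+ 2 <= c * d by rewrite expr2 ler_pM ?(ltW lam_gt0).
  have cd2 : c * d <= 1.
    by rewrite mulr_ile1 // (le_trans (ltW lam_gt0)).
  rewrite -mulrA ler_wpM2l //=; rewrite -[leRHS]mulr1 ler_wpM2l //.
have q0 : 0 <= 1 - p by rewrite subr_ge0 (le_trans p2) // gerBl ltW.
have h1 : 0 <= rho * (1 - p) by rewrite mulr_ge0.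
have h2 : 0 <= (1 - rho) * (1 - p) by rewrite mulr_ge0 // subr_ge0.
have h3 : 0 <= rho * p by rewrite mulr_ge0 // (le_trans (ltW lam_gt0)).
have h4 : 0 <= (1 - rho) * p.
  by rewrite mulr_ge0 ?subr_ge0 // (le_trans (ltW lam_gt0)).
case: a.
  rewrite (_ : bit_kernel _ _ _ _ * _ = (1 - rho) * (1 - p) * (rho + (1 - rho) * p)).
    by apply: H; lra.
  by rewrite /bit_kernel /bit_weight /=; ring.
rewrite (_ : bit_kernel _ _ _ _ * _ = (1 - rho) * p * (rho + (1 - rho) * (1 - p))).
  by apply: H; lra.
by rewrite /bit_kernel /bit_weight /=; ring.
Qed.

Lemma sum_noise_cons_derivative (F : R -> R) i l rho g x : i \notin l ->
  \sum_(j <- l) F (T (on l rho) (D j (T (on [:: i] rho) g)) x) =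
  \sum_(j <- l) F (T (on (i :: l) rho) (D j g) x).
Proof.
move=> il; rewrite big_seq [RHS]big_seq; apply: eq_bigr => j jl; congr F.
rewrite noise_cons //; apply: eq_noise => // y; rewrite derivative_noise /on inE.
by case: eqP jl il => [->->//|_ _ _]; rewrite mul1r.
Qed.

Lemma noise_cons_indep i l rho g x : indep_of_bit i g ->
  T (on (i :: l) rho) g x = T (on l rho) g x.
Proof.
by move=> gi; apply: (noise_indep_rate _ _ gi) => j ji; rewrite /on inE (negPf ji).
Qed.

Lemma variance_cons i l rho g x : i \notin l ->
  variance (on (i :: l) rho) g x =
  T (on l rho) (variance (on [:: i] rho) g) x +
  variance (on l rho) (T (on [:: i] rho) g) x.
Proof.
by move=> il; rewrite /variance !noise_cons // noiseB; ring.
Qed.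

(** Resampling the bits one after the other decomposes the variance into the
    contributions of single bits; Jensen's inequality then lets the remaining
    resamplings act inside the square; bounding the other way, in
    [variance_le], they act outside. *)
Lemma variance_ge l rho g x : uniq l -> 0 <= rho <= 1 ->
  (1 - rho) * lam ^+ 2 * \sum_(i <- l) T (on l rho) (D i g) x ^+ 2 <=
  variance (on l rho) g x.
Proof.
move=> ul r01; elim: l ul g x => [|i l IH] /= => [_|/andP[il ul]] g x.
  by rewrite big_nil mulr0 subr_ge0; exact/noise_sqr/rates_on.
rewrite big_cons variance_cons // mulrDr lerD //; last first.
  rewrite -(sum_noise_cons_derivative (fun t => t ^+ 2)) //; exact: IH.
rewrite noise_cons_indep; last exact: derivative_indep.
have c0 : 0 <= (1 - rho) * lam ^+ 2.
  by rewrite mulr_ge0 ?sqr_ge0 // subr_ge0; case/andP: r01.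
apply: le_trans (ler_wpM2l c0 (noise_sqr _ _ (rates_on l r01))) _.
rewrite -noiseZ; apply: noise_le; first exact: rates_on.
move=> y; rewrite variance_one ler_wpM2r ?sqr_ge0 //.
by case/andP: (bit_kernel_spread (y i) r01).
Qed.

Lemma variance_le l rho g x : uniq l -> 0 <= rho <= 1 ->
  variance (on l rho) g x <=
  (1 - rho) * \sum_(i <- l) T (on l rho) (fun y => D i g y ^+ 2) x.
Proof.
move=> ul r01; elim: l ul g x => [|i l IH] /= => [_|/andP[il ul]] g x.
  rewrite big_nil mulr0 /variance.
  have E0 h : T (on [::] rho) h x = h x by rewrite -[RHS](noise_id p).
  by rewrite !E0 subrr.
have c0 : 0 <= 1 - rho by rewrite subr_ge0; case/andP: r01.
rewrite big_cons variance_cons // mulrDr lerD //.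
  rewrite noise_cons_indep; last by move=> a y; rewrite derivative_indep.
  rewrite -noiseZ; apply: noise_le; first exact: rates_on.
  move=> y; rewrite variance_one ler_wpM2r ?sqr_ge0 //.
  by case/andP: (bit_kernel_spread (y i) r01).
apply: le_trans (IH ul _ _) _; rewrite ler_wpM2l //.
rewrite big_seq [leRHS]big_seq; apply: ler_sum => j jl.
rewrite noise_cons //; apply: noise_le; first exact: rates_on.
move=> y; rewrite derivative_noise /on inE.
have -> : (j == i) = false by case: eqP jl il => // -> ->.
by rewrite mul1r; apply: noise_sqr; exact: rates_on.
Qed.

Lemma on_enum rho j : on (enum 'I_n) rho j = rho.
Proof. by rewrite /on mem_enum. Qed.

Lemma variance_ge_all rho g x : 0 <= rho <= 1 ->
  (1 - rho) * lam ^+ 2 * \sum_i T (fun=> rho) (D i g) x ^+ 2 <=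
  variance (fun=> rho) g x.
Proof.
move=> r01; have := @variance_ge (enum 'I_n) rho g x (enum_uniq _) r01.
have e h y : T (on (enum 'I_n) rho) h y = T (fun=> rho) h y.
  by apply: eq_noise => // j; exact: on_enum.
rewrite /variance !e big_enum; congr (_ * _ <= _).
by apply: eq_bigr => j _; rewrite e.
Qed.

Lemma variance_le_all rho g x : 0 <= rho <= 1 ->
  variance (fun=> rho) g x <=
  (1 - rho) * \sum_i T (fun=> rho) (fun y => D i g y ^+ 2) x.
Proof.
move=> r01; have := @variance_le (enum 'I_n) rho g x (enum_uniq _) r01.
have e h y : T (on (enum 'I_n) rho) h y = T (fun=> rho) h y.
  by apply: eq_noise => // j; exact: on_enum.
rewrite /variance !e big_enum; congr (_ <= _ * _).
by apply: eq_bigr => j _; rewrite e.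
Qed.

Lemma expect_variance r g :
  E (variance r g) = E (fun x => g x ^+ 2) - E (fun x => T r g x ^+ 2).
Proof. by rewrite expectB expect_noise. Qed.

(** Bit by bit: what averaging bit [i] removes from the averaged function is at
    most what it removes from the noised function, because averaging the other
    bits is a contraction that commutes with it. *)
Lemma spectral_gap_on l rho g : uniq l -> 0 <= rho <= 1 ->
  (1 - rho) * lam ^+ 2 *
    (E (fun x => g x ^+ 2) - E (fun x => T (on l 0) g x ^+ 2)) <=
  E (fun x => g x ^+ 2) - E (fun x => T (on l rho) g x ^+ 2).
Proof.
move=> ul r01; have r00 : 0 <= (0 : R) <= 1 by rewrite lexx ler01.
have c0 : 0 <= (1 - rho) * lam ^+ 2.
  by rewrite mulr_ge0 ?sqr_ge0 // subr_ge0; case/andP: r01.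
elim: l ul => [_|i l IH /= /andP[il ul]].
  (* Both operators on an empty list of bits are the identity. *)
  rewrite (@eq_expect _ _ _ (fun x => T (on [::] 0) g x ^+ 2) (fun x => g x ^+ 2)); last first.
    by move=> x; rewrite -[g x](noise_id p).
  by rewrite !subrr mulr0.
have step sigma : E (fun x => T (on (i :: l) sigma) g x ^+ 2) =
    E (fun x => T (on l sigma) g x ^+ 2) -
    E (variance (on [:: i] sigma) (T (on l sigma) g)).
  rewrite expect_variance subKr; apply: eq_expect => x.
  by rewrite noise_cons // noise_comm.
rewrite !step.
suff H : (1 - rho) * lam ^+ 2 * E (variance (on [:: i] 0) (T (on l 0) g)) <=
    E (variance (on [:: i] rho) (T (on l rho) g)).
  by have := IH ul; lra.
have il1 sigma : on l sigma i = 1 by rewrite /on (negPf il).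
apply: (@le_trans _ _ ((1 - rho) * lam ^+ 2 * E (fun x => D i (T (on l rho) g) x ^+ 2))).
  rewrite ler_wpM2l //.
  apply: (@le_trans _ _ (E (fun x => T (on l 0) (D i (T (on l rho) g)) x ^+ 2))).
    apply: le_expect => x; rewrite variance_one -derivative_noise1 //.
    rewrite -[leRHS]mul1r.
    rewrite (_ : D i (T (on l 0) (T (on l rho) g)) x = D i (T (on l 0) g) x).
      by rewrite ler_wpM2r ?sqr_ge0 //; case/andP: (bit_kernel_spread (x i) r00); rewrite subr0.
    by congr (_ - _); rewrite noise_comp; apply: eq_noise => // j;
      rewrite /on; case: ifP; rewrite ?mul0r ?mulr1.
  exact/expect_noise_sqr/rates_on.
rewrite -expectZ; apply: le_expect => x.
rewrite variance_one ler_wpM2r ?sqr_ge0 //.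
by case/andP: (bit_kernel_spread (x i) r01).
Qed.

Lemma spectral_gap rho g : 0 <= rho <= 1 ->
  (1 - rho) * lam ^+ 2 * (E (fun x => g x ^+ 2) - E g ^+ 2) <=
  E (fun x => g x ^+ 2) - E (fun x => T (fun=> rho) g x ^+ 2).
Proof.
move=> r01; have := @spectral_gap_on (enum 'I_n) rho g (enum_uniq _) r01.
have e sigma : E (fun x => T (on (enum 'I_n) sigma) g x ^+ 2) =
    E (fun x => T (fun=> sigma) g x ^+ 2).
  by apply: eq_expect => x; congr (_ ^+ 2); apply: eq_noise => // j; exact: on_enum.
rewrite !e; congr (_ * (_ - _) <= _).
rewrite -[RHS]expect_cst; apply: eq_expect => x.
by rewrite expect_noise0.
Qed.

End Contraction.
(** * Gradients of noised functions and hypercontractivity *)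

Section Smoothing.
Variables (R : realFieldType) (n : nat) (p lam : R).
Hypothesis lam_gt0 : 0 < lam.
Hypothesis p_lam : lam <= p <= 1 - lam.
Implicit Types (r s : 'I_n -> R) (g h u : cube n -> R) (x y z : cube n)
  (i j : 'I_n) (a b : bool) (l : seq 'I_n) (rho K : R).

Local Notation T := (noise p).
Local Notation E := (expect p).
Local Notation D := discrete_derivative.
Let le_T := @noise_le R n p lam lam_gt0 p_lam.

(** A noised function has a bounded gradient at every point, not only on
    average, since the gradient is dominated by the variance of [g] under the
    noise started from that point. *)
Lemma gradient_bound rho g x : 0 <= rho <= 1 -> (forall y, `|g y| <= 1) ->
  (1 - rho) * lam ^+ 2 * \sum_i D i (T (fun=> rho) g) x ^+ 2 <= 1.
Proof.
move=> r01 g1; have /andP[r0 r1] := r01.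
apply: (@le_trans _ _ (variance p (fun=> rho) g x)).
  apply: le_trans (variance_ge_all lam_gt0 p_lam g x r01).
  rewrite ler_wpM2l ?mulr_ge0 ?subr_ge0 ?(ltW lam_gt0) //; apply: ler_sum => i _.
  rewrite derivative_noise exprMn -[leRHS]mul1r ler_wpM2r ?sqr_ge0 //.
  by rewrite expr_le1.
rewrite /variance lerBlDr; apply: (@le_trans _ _ 1); last by rewrite lerDl sqr_ge0.
rewrite -[leRHS](noise_cst p (fun=> rho) 1 x); apply: le_T; first exact: rates_cst.
by move=> y; rewrite -real_normK ?num_real // expr_le1.
Qed.

Lemma derivative_square_shift i u c x :
  D i (fun y => (u y - c) ^+ 2) x ^+ 2 <=
  8 * (D i u x ^+ 2 * (u x - c) ^+ 2) + 2 * D i u x ^+ 4.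
Proof.
have -> : u x = u (set_bit i (x i) x) by rewrite set_bit_id.
rewrite /D.
have H (s t w : R) : w ^+ 2 = s ^+ 2 -> (s * (2 * t - w)) ^+ 2 <= 8 * (s ^+ 2 * t ^+ 2) + 2 * s ^+ 4.
  move=> ws; rewrite exprMn.
  have -> : 8 * (s ^+ 2 * t ^+ 2) + 2 * s ^+ 4 = s ^+ 2 * (8 * t ^+ 2 + 2 * w ^+ 2).
    by rewrite ws; ring.
  by rewrite ler_wpM2l ?sqr_ge0 // -subr_ge0 (_ : _ - _ = (2 * t + w) ^+ 2) ?sqr_ge0 //; ring.
case: (x i); move: (u (set_bit i true x)) (u (set_bit i false x)) => a b.
  rewrite (_ : (a - c) ^+ 2 - (b - c) ^+ 2 = (a - b) * (2 * (a - c) - (a - b))); last by ring.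
  exact: H.
rewrite (_ : (a - c) ^+ 2 - (b - c) ^+ 2 = (a - b) * (2 * (b - c) - (b - a))); last by ring.
by apply: H; ring.
Qed.

Lemma noise_variance rho u x :
  T (fun=> rho) (fun y => (u y - T (fun=> rho) u x) ^+ 2) x =
  variance p (fun=> rho) u x.
Proof. by rewrite noise_sqr_center /variance; ring. Qed.

(** The variance bound [variance_le_all] applied twice: to [u], and to the square
    of the centred [u], whose gradient is that of [u] times the centred [u]. *)
Lemma fourth_moment_noise rho K u x : 0 <= rho <= 1 ->
  (forall y, \sum_i D i u y ^+ 2 <= K) ->
  T (fun=> rho) (fun y => (u y - T (fun=> rho) u x) ^+ 4) x <=
  9 * ((1 - rho) * K) ^+ 2 +
  2 * (1 - rho) * \sum_i T (fun=> rho) (fun y => D i u y ^+ 4) x.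
Proof.
move=> r01 DK; have /andP[r0 r1] := r01.
set c := T _ u x; have rr := rates_cst (n := n) r01.
have d0 : 0 <= 1 - rho by rewrite subr_ge0.
have V1 : variance p (fun=> rho) u x <= (1 - rho) * K.
  apply: le_trans (variance_le_all lam_gt0 p_lam u x r01) _.
  rewrite ler_wpM2l // -noise_sum -[leRHS](noise_cst p (fun=> rho) K x).
  exact: le_T.
have V0 : 0 <= variance p (fun=> rho) u x.
  by rewrite /variance subr_ge0; apply: (noise_sqr lam_gt0 p_lam).
pose g y := (u y - c) ^+ 2.
have gV : T (fun=> rho) g x = variance p (fun=> rho) u x by rewrite noise_variance.
have -> : T (fun=> rho) (fun y => (u y - c) ^+ 4) x =
    variance p (fun=> rho) g x + variance p (fun=> rho) u x ^+ 2.
  rewrite -gV /variance subrK; apply: eq_noise => // y.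
  by rewrite /g -exprM.
have Vg : variance p (fun=> rho) g x <= (1 - rho) *
    (8 * K * variance p (fun=> rho) u x +
     2 * \sum_i T (fun=> rho) (fun y => D i u y ^+ 4) x).
  apply: le_trans (variance_le_all lam_gt0 p_lam g x r01) _.
  rewrite ler_wpM2l // -!noise_sum -gV -!noiseZ -noiseD.
  apply: le_T => // y.
  apply: (@le_trans _ _ (\sum_i (8 * (D i u y ^+ 2 * (u y - c) ^+ 2) + 2 * D i u y ^+ 4))).
    by apply: ler_sum => i _; exact: derivative_square_shift.
  rewrite big_split -!big_distrr -big_distrl /= lerD2r -mulrA ler_wpM2l //.
  by rewrite ler_wpM2r ?sqr_ge0.
set S := \sum_i _ in Vg *; set V := variance _ _ u _ in Vg V1 V0 *.
set W := variance _ _ g _ in Vg *.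
have K0 : 0 <= K.
  by apply: le_trans (DK x); apply: sumr_ge0 => i _; exact: sqr_ge0.
have dK0 : 0 <= (1 - rho) * K by rewrite mulr_ge0.
have h1 : V ^+ 2 <= ((1 - rho) * K) ^+ 2 by rewrite ler_sqr.
have h2 : (1 - rho) * K * V <= ((1 - rho) * K) ^+ 2.
  by rewrite expr2 ler_wpM2l.
lra.
Qed.

Lemma expect_fourth_moment_noise rho K u : 0 <= rho <= 1 ->
  (forall y, \sum_i D i u y ^+ 2 <= K) ->
  E (fun x => T (fun=> rho) (fun y => (u y - T (fun=> rho) u x) ^+ 4) x) <=
  9 * ((1 - rho) * K) ^+ 2 + 2 * (1 - rho) * \sum_i E (fun y => D i u y ^+ 4).
Proof.
move=> r01 DK.
apply: le_trans (le_expect lam_gt0 p_lam (fun x => fourth_moment_noise x r01 DK)) _.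
rewrite expectD expect_cst expectZ expect_sum lerD2l.
rewrite le_eqVlt; apply/orP; left; apply/eqP; congr (_ * _).
by apply: eq_bigr => i _; rewrite expect_noise.
Qed.

(** The quadratic form [pos] is nonnegative; its discriminant gives the bound. *)
Lemma noise_Cauchy_Schwarz r g h x : rates r ->
  T r (fun y => g y * h y) x ^+ 2 <=
  T r (fun y => g y ^+ 2) x * T r (fun y => h y ^+ 2) x.
Proof.
move=> rr; set b := T r _ x; set a := T r _ x; set c := T r _ x.
have pos (s t : R) : 0 <= s ^+ 2 * a + 2 * s * t * b + t ^+ 2 * c.
  have -> : s ^+ 2 * a + 2 * s * t * b + t ^+ 2 * c =
      T r (fun y => (s * g y + t * h y) ^+ 2) x.
    by rewrite /a /b /c -!noiseZ -!noiseD; apply: eq_noise => // y; ring.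
  by apply: (noise_ge0 lam_gt0 p_lam) => // y; exact: sqr_ge0.
have a0 : 0 <= a by have := pos 1 0; lra.
have c0 : 0 <= c by have := pos 0 1; lra.
have [a_eq0|an0] := eqVneq a 0.
  rewrite a_eq0 mul0r.
  have [->|b0] := eqVneq b 0; first by rewrite expr0n.
  have := pos (- (c + 1) / (2 * b)) 1.
  rewrite a_eq0 mulr0 add0r mulr1 expr1n mul1r.
  have -> : 2 * (- (c + 1) / (2 * b)) * b = - (c + 1) by field.
  lra.
have a_gt0 : 0 < a by rewrite lt_neqAle eq_sym an0.
have := pos (- b) a.
have -> : (- b) ^+ 2 * a + 2 * - b * a * b + a ^+ 2 * c = a * (a * c - b ^+ 2) by ring.
by rewrite pmulr_rge0 // subr_ge0.
Qed.

Lemma expect_Cauchy_Schwarz g h :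
  E (fun y => g y * h y) ^+ 2 <= E (fun y => g y ^+ 2) * E (fun y => h y ^+ 2).
Proof.
by rewrite -!(expect_noise0 p _ [ffun=> true]); apply/noise_Cauchy_Schwarz/rates0.
Qed.

Definition centered_bit b : R := b%:R - p.

(** One bit of the inequality [hypercontractive_on]: for [rho] at most the
    variance of a bit, the odd term and the fourth power are absorbed by the
    quadratic terms, however biased the bit is. *)
Lemma two_point_fourth_moment rho i (A B : cube n -> R) x :
  0 <= rho -> rho <= p * (1 - p) -> indep_of_bit i A -> indep_of_bit i B ->
  T (on [:: i] 0) (fun y => (A y + rho * (centered_bit (y i) * B y)) ^+ 4) x <=
  A x ^+ 4 + (2 * (p * (1 - p))) * (A x ^+ 2 * B x ^+ 2) +
  (p * (1 - p)) ^+ 2 * B x ^+ 4.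
Proof.
move=> r0 rv Ai Bi; rewrite noise_one !bit_kernel0 !set_bit_same !Ai !Bi.
rewrite /bit_weight /centered_bit /=.
move: (A x) (B x) => a b; set v := p * (1 - p) in rv *.
have /andP[p1 p2] := p_lam.
have p0 : 0 <= p by rewrite (le_trans _ p1) ?ltW.
have q0 : 0 <= 1 - p by have := lam_gt0; lra.
have v0 : 0 <= v by rewrite mulr_ge0.
have v4 : v <= 1/4.
  have := sqr_ge0 (p - 1/2); rewrite /v; lra.
(* The centred bit has moments 0, [v], [m] and [m4]. *)
pose m := v * (1 - 2 * p).
pose m4 := v * (1 - 3 * v).
have -> : p * (a + rho * ((1 - p) * b)) ^+ 4 + (1 - p) * (a + rho * ((0 - p) * b)) ^+ 4 =
  a ^+ 4 + 6 * rho ^+ 2 * v * (a ^+ 2 * b ^+ 2) + 4 * rho ^+ 3 * m * (a * b ^+ 3) +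
  rho ^+ 4 * m4 * b ^+ 4 by rewrite /m /m4 /v; ring.
clearbody v.
have odd_term : m * (a * b ^+ 3) <= v / 2 * (a ^+ 2 * b ^+ 2 + b ^+ 4).
  rewrite /m -mulrA -[leRHS]mulrA ler_wpM2l //.
  have s1 := sqr_ge0 (a * b - b ^+ 2); have s2 := sqr_ge0 (a * b + b ^+ 2).
  have : 0 <= p * (a * b + b ^+ 2) ^+ 2 + (1 - p) * (a * b - b ^+ 2) ^+ 2.
    by rewrite addr_ge0 // mulr_ge0.
  lra.
have X0 : 0 <= a ^+ 2 * b ^+ 2 by rewrite mulr_ge0 ?sqr_ge0.
have Y0 : 0 <= b ^+ 4 by rewrite (exprM b 2 2) sqr_ge0.
move: (a ^+ 2 * b ^+ 2) (b ^+ 4) (a * b ^+ 3) (a ^+ 4) odd_term X0 Y0 => X Y Z W odd_term X0 Y0.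
have rho4 : rho <= 1/4 by lra.
have r2 : rho ^+ 2 <= 1/16 by nra.
have r3 : rho ^+ 3 <= rho / 16 by rewrite exprSr exprS; nra.
have r30 : 0 <= rho ^+ 3 by rewrite exprn_ge0.
have r4 : rho ^+ 4 <= rho / 64.
  by rewrite exprS; apply: ler_wpM2l => //; lra.
have t1 : 4 * rho ^+ 3 * m * Z <= 2 * rho ^+ 3 * v * (X + Y).
  have := ler_wpM2l r30 odd_term; lra.
have t2 : rho ^+ 4 * m4 * Y <= v / 64 * v * Y.
  rewrite ler_wpM2r //; apply: ler_pM.
  - by rewrite exprn_ge0.
  - by rewrite mulr_ge0 //; lra.
  - by lra.
  - by rewrite -[leRHS]mulr1 ler_wpM2l //; lra.
have vX : 0 <= v * X by rewrite mulr_ge0.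
have vY : 0 <= v * Y by rewrite mulr_ge0.
have t3 : rho ^+ 2 * (v * X) <= 1/16 * (v * X) by rewrite ler_wpM2r.
have t4 : rho ^+ 3 * (v * X) <= 1/64 * (v * X) by rewrite ler_wpM2r //; lra.
have t5 : rho ^+ 3 * (v * Y) <= v / 16 * (v * Y) by rewrite ler_wpM2r //; lra.
have vvY : 0 <= v * (v * Y) by rewrite mulr_ge0.
lra.
Qed.

(** Hypercontractivity from exponent 2 to exponent 4, proved bit by bit: over
    one bit the inequality is a polynomial one, and the cross terms of the
    other bits are handled by the Cauchy-Schwarz inequality. *)
Lemma hypercontractive_on l rho g x : uniq l -> 0 <= rho <= p * (1 - p) ->
  T (on l 0) (fun y => T (on l rho) g y ^+ 4) x <=
  (T (on l 0) (fun y => g y ^+ 2) x) ^+ 2.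
Proof.
move=> ul /andP[r0 rv]; elim: l ul g x => [_|i l IH /= /andP[il ul]] g x.
  have e h y : T (on [::] rho) h y = h y by rewrite -[RHS](noise_id p).
  have -> : T (on [::] 0) (fun y => g y ^+ 2) x = g x ^+ 2 by exact: e.
  have -> : T (on [::] 0) (fun y => T (on [::] rho) g y ^+ 4) x = T (on [::] rho) g x ^+ 4.
    exact: e.
  by rewrite e -exprM.
have r00 : rates (n := n) (on l (0 : R)) by apply: rates_on; rewrite lexx ler01.
pose A := T (on [:: i] 0) g; pose B := D i g; set v := p * (1 - p) in rv *.
have Bi : indep_of_bit i B by exact: derivative_indep.
have Ai : indep_of_bit i A by move=> b y; rewrite /A !noise_one !bit_kernel0 !set_bit_set.
have v0 : 0 <= v by lra.
have split_noise y : T (on (i :: l) rho) g y =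
    T (on l rho) A y + rho * (centered_bit (y i) * T (on l rho) B y).
  rewrite noise_cons //.
  have E1 z : T (on [:: i] rho) g z = A z + rho * (centered_bit (z i) * B z).
    rewrite /A noise_one /B !noise_one /bit_kernel /bit_weight /centered_bit /D.
    by case: (z i) => /=; ring.
  rewrite (eq_noise p y (fun=> erefl) E1) noiseD noiseZ noise_fixed_bit //.
  by rewrite /on (negPf il).
have sq y : T (on [:: i] 0) (fun z => g z ^+ 2) y = A y ^+ 2 + v * B y ^+ 2.
  rewrite /A /B !noise_one !bit_kernel0 /bit_weight /D /v; ring.
rewrite noise_cons // [in leRHS]noise_cons //.
rewrite (eq_noise p x (fun=> erefl) sq) noiseD noiseZ.
pose A' := T (on l rho) A; pose B' := T (on l rho) B.
apply: (@le_trans _ _ (T (on l 0) (fun y => A' y ^+ 4 +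
    (2 * v) * (A' y ^+ 2 * B' y ^+ 2) + v ^+ 2 * B' y ^+ 4) x)).
  apply: le_T => // y.
  rewrite (eq_noise p y (fun=> erefl) (fun z => congr1 (fun t => t ^+ 4) (split_noise z))).
  by apply: two_point_fourth_moment => //; exact: noise_indep.
rewrite !noiseD !noiseZ.
have hA := IH ul A x; have hB := IH ul B x.
set al := T (on l 0) (fun y => A y ^+ 2) x in hA *.
set be := T (on l 0) (fun y => B y ^+ 2) x in hB *.
have al0 : 0 <= al by apply: (noise_ge0 lam_gt0 p_lam) => // y; exact: sqr_ge0.
have be0 : 0 <= be by apply: (noise_ge0 lam_gt0 p_lam) => // y; exact: sqr_ge0.
have hAB : T (on l 0) (fun y => A' y ^+ 2 * B' y ^+ 2) x <= al * be.
  rewrite -ler_sqr ?nnegrE ?mulr_ge0 //; last first.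
    by apply: (noise_ge0 lam_gt0 p_lam) => // y; rewrite mulr_ge0 ?sqr_ge0.
  apply: le_trans (noise_Cauchy_Schwarz _ _ _ r00) _.
  rewrite exprMn; apply: ler_pM.
  - by apply: (noise_ge0 lam_gt0 p_lam) => // y; exact: sqr_ge0.
  - by apply: (noise_ge0 lam_gt0 p_lam) => // y; exact: sqr_ge0.
  - by apply: le_trans hA; apply: le_T => // y; rewrite -exprM.
  - by apply: le_trans hB; apply: le_T => // y; rewrite -exprM.
have -> : (al + v * be) ^+ 2 = al ^+ 2 + 2 * v * (al * be) + v ^+ 2 * be ^+ 2 by ring.
apply: lerD; last by rewrite ler_wpM2l ?sqr_ge0.
by apply: lerD => //; rewrite ler_wpM2l // mulr_ge0.
Qed.

Lemma hypercontractive rho g : 0 <= rho <= p * (1 - p) ->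
  E (fun y => T (fun=> rho) g y ^+ 4) <= (E (fun y => g y ^+ 2)) ^+ 2.
Proof.
move=> hr; have := @hypercontractive_on (enum 'I_n) rho g [ffun=> true] (enum_uniq _) hr.
have e h : T (on (enum 'I_n) 0) h [ffun=> true] = E h.
  by rewrite -(expect_noise0 p h [ffun=> true]); apply: eq_noise => // j; exact: on_enum.
rewrite !e; congr (_ <= _); apply: eq_expect => y; congr (_ ^+ 4).
by apply: eq_noise => // j; exact: on_enum.
Qed.

End Smoothing.
(** * Small sets and small influences *)

Section SmallSets.
Variables (R : realFieldType) (n : nat) (p lam : R).
Hypothesis lam_gt0 : 0 < lam.
Hypothesis p_lam : lam <= p <= 1 - lam.
Implicit Types (g f u : cube n -> R) (x y : cube n) (A : pred (cube n))
  (rho sigma kappa theta : R).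

Local Notation T := (noise p).
Local Notation E := (expect p).
Local Notation D := discrete_derivative.

Definition indicator A x : R := (A x)%:R.

(** The probability of being in [A] at two times with correlation [rho]. *)
Definition stay_in A rho := E (fun x => indicator A x * T (fun=> rho) (indicator A) x).

Lemma indicator_sqr A x : indicator A x ^+ 2 = indicator A x.
Proof. by rewrite /indicator; case: (A x); rewrite ?expr1n ?expr0n. Qed.

Lemma indicator_itv A x : 0 <= indicator A x <= 1.
Proof. by rewrite /indicator; case: (A x); rewrite ?lexx ?ler01. Qed.

Lemma noise_itv rho g x : 0 <= rho <= 1 -> (forall y, 0 <= g y <= 1) ->
  0 <= T (fun=> rho) g x <= 1.
Proof.
move=> r01 g01; have rr := rates_cst (n := n) r01; apply/andP; split.
  by apply: (noise_ge0 lam_gt0 p_lam) => // y; case/andP: (g01 y).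
rewrite -[leRHS](noise_cst p (fun=> rho) 1 x).
by apply: (noise_le lam_gt0 p_lam) => // y; case/andP: (g01 y).
Qed.

Lemma stay_in_ge0 A rho : 0 <= rho <= 1 -> 0 <= stay_in A rho.
Proof.
move=> r01; apply: (expect_ge0 lam_gt0 p_lam) => x.
have /andP[i0 _] := indicator_itv A x.
have /andP[t0 _] := noise_itv x r01 (indicator_itv A).
exact: mulr_ge0.
Qed.

Lemma stay_in_sqr A rho :
  stay_in A (rho ^+ 2) = E (fun x => T (fun=> rho) (indicator A) x ^+ 2).
Proof.
rewrite /stay_in; under [RHS]eq_expect do rewrite expr2.
rewrite -expect_noise_sym; apply: eq_expect => x; congr (_ * _).
by rewrite noise_comp; apply: eq_noise.
Qed.

Lemma expect_indicator_ge0 A : 0 <= E (indicator A).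
Proof. by apply: (expect_ge0 lam_gt0 p_lam) => x; case/andP: (indicator_itv A x). Qed.

(** Log-convexity in time, by the Cauchy-Schwarz inequality and the symmetry of
    the noise. *)
Lemma stay_in_log_convex A rho :
  stay_in A rho ^+ 2 <= E (indicator A) * stay_in A (rho ^+ 2).
Proof.
rewrite stay_in_sqr; apply: le_trans (expect_Cauchy_Schwarz lam_gt0 p_lam _ _) _.
by under eq_expect do rewrite indicator_sqr.
Qed.

(** The factor on the left replaces a division by a possibly null probability. *)
Lemma stay_in_iter A rho j : 0 <= rho <= 1 ->
  E (indicator A) * stay_in A rho ^+ (2 ^ j) <=
  E (indicator A) ^+ (2 ^ j) * stay_in A (rho ^+ (2 ^ j)).
Proof.
have P0 := expect_indicator_ge0 A.
elim: j rho => [|j IH] rho r01; first by rewrite !expr1.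
have r2 : 0 <= rho ^+ 2 <= 1.
  by case/andP: r01 => r0 r1; rewrite exprn_ge0 // expr_le1.
rewrite expnS !exprM.
apply: (@le_trans _ _ (E (indicator A) * (E (indicator A) * stay_in A (rho ^+ 2)) ^+ (2 ^ j))).
  rewrite ler_wpM2l // lerXn2r ?nnegrE ?exprn_ge0 ?mulr_ge0 ?stay_in_ge0 //.
  exact: stay_in_log_convex.
rewrite exprMn mulrCA -exprM mulnC exprM expr2 -[leRHS]mulrA.
by rewrite ler_wpM2l ?exprn_ge0 // IH.
Qed.

(** By duality with the four-norm bound: the indicator of [A] has a small
    four-thirds norm. *)
Lemma stay_in_long_time A rho : 0 <= rho <= p * (1 - p) ->
  stay_in A rho ^+ 4 <= E (indicator A) ^+ 5.
Proof.
move=> rv; have P0 := expect_indicator_ge0 A.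
set G := E (fun x => indicator A x * T (fun=> rho) (indicator A) x ^+ 2).
have G0 : 0 <= G.
  apply: (expect_ge0 lam_gt0 p_lam) => x.
  have /andP[i0 _] := indicator_itv A x.
  by rewrite mulr_ge0 ?sqr_ge0.
have h1 : stay_in A rho ^+ 2 <= E (indicator A) * G.
  have -> : stay_in A rho =
      E (fun x => indicator A x * (indicator A x * T (fun=> rho) (indicator A) x)).
    by apply: eq_expect => x; rewrite mulrA -expr2 indicator_sqr.
  apply: le_trans (expect_Cauchy_Schwarz lam_gt0 p_lam _ _) _.
  under eq_expect do rewrite indicator_sqr.
  by under [X in _ * X]eq_expect do rewrite exprMn indicator_sqr.
have h2 : G ^+ 2 <= E (indicator A) ^+ 3.
  apply: le_trans (expect_Cauchy_Schwarz lam_gt0 p_lam _ _) _.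
  under eq_expect do rewrite indicator_sqr.
  under [X in _ * X]eq_expect do rewrite -exprM.
  rewrite exprS ler_wpM2l //.
  apply: le_trans (hypercontractive lam_gt0 p_lam _ rv) _.
  by under eq_expect do rewrite indicator_sqr.
rewrite (exprM _ 2 2).
apply: (@le_trans _ _ ((E (indicator A) * G) ^+ 2)).
  by rewrite lerXn2r ?nnegrE ?sqr_ge0 ?mulr_ge0.
rewrite exprMn (exprD _ 2 3) ler_wpM2l ?sqr_ge0 //.
Qed.

Lemma stay_in_le A rho : 0 <= rho <= 1 -> stay_in A rho <= E (indicator A).
Proof.
move=> r01; apply: (le_expect lam_gt0 p_lam) => x.
have /andP[i0 _] := indicator_itv A x.
by rewrite -[leRHS]mulr1 ler_wpM2l //; case/andP: (noise_itv x r01 (indicator_itv A)).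
Qed.

(** Small sets are quickly left: hypercontractivity gives this after a long
    time, and log-convexity transports it to a short one. *)
Lemma small_set_expansion A rho kappa j : 0 <= rho <= 1 ->
  rho ^+ (2 ^ j) <= p * (1 - p) -> 0 <= kappa ->
  E (indicator A) <= kappa ^+ (4 * 2 ^ j) ->
  stay_in A rho <= kappa * E (indicator A).
Proof.
move=> r01 rv k0 Ak; have P0 := expect_indicator_ge0 A.
have r00 : 0 <= rho by case/andP: r01.
have [P_eq0|P_neq0] := eqVneq (E (indicator A)) 0.
  by have := stay_in_le A r01; rewrite P_eq0 mulr0.
have P_gt0 : 0 < E (indicator A) by rewrite lt_neqAle eq_sym P_neq0.
have q0 : (0 < 4 * 2 ^ j)%N by rewrite muln_gt0 expn_gt0.
rewrite -(ler_pXn2r q0) ?nnegrE ?mulr_ge0 ?stay_in_ge0 //.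
rewrite exprMn; apply: le_trans (_ : E (indicator A) ^+ (4 * 2 ^ j).+1 <= _); last first.
  by rewrite exprS ler_wpM2r ?exprn_ge0.
have rr : 0 <= rho ^+ (2 ^ j) <= p * (1 - p) by rewrite exprn_ge0.
have rr1 : 0 <= rho ^+ (2 ^ j) <= 1.
  by rewrite exprn_ge0 //= exprn_ile1 //; case/andP: r01.
rewrite -(ler_pM2l (exprn_gt0 4 P_gt0)).
rewrite [(4 * _)%N]mulnC exprM -exprMn.
apply: (@le_trans _ _ ((E (indicator A) ^+ (2 ^ j) * stay_in A (rho ^+ (2 ^ j))) ^+ 4)).
  rewrite lerXn2r ?nnegrE ?stay_in_iter //.
    by rewrite mulr_ge0 // exprn_ge0 // stay_in_ge0.
  by rewrite mulr_ge0 // ?exprn_ge0 // stay_in_ge0.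
rewrite exprMn -exprM.
rewrite -exprD addnS -addSn addnC exprD.
by rewrite ler_wpM2l ?exprn_ge0 //; exact: stay_in_long_time.
Qed.

Lemma noise_unit_norm rho f x : 0 <= rho <= 1 -> (forall y, 0 <= f y <= 1) ->
  `|T (fun=> rho) f x| <= 1.
Proof.
by move=> r01 /(noise_itv x r01)/andP[h0 h1]; rewrite ger0_norm.
Qed.

Lemma derivative_itv i f x : (forall y, 0 <= f y <= 1) -> `|D i f x| <= 1.
Proof.
move=> f01; rewrite /D ler_norml.
by have := f01 (set_bit i true x); have := f01 (set_bit i false x); lra.
Qed.

Lemma markov_indicator theta g :  0 < theta ->
  theta * E (indicator (fun x => theta < `|g x|)) <= E (fun x => `|g x|).
Proof.
move=> t0; rewrite -expectZ; apply: (le_expect lam_gt0 p_lam) => x.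
rewrite /indicator; case: ltP => [/ltW|_]; first by rewrite mulr1.
by rewrite mulr0.
Qed.

Lemma chebyshev_indicator theta g :  0 < theta ->
  theta ^+ 2 * E (indicator (fun x => theta < `|g x|)) <= E (fun x => g x ^+ 2).
Proof.
move=> t0; rewrite -expectZ; apply: (le_expect lam_gt0 p_lam) => x.
rewrite /indicator; case: ltP => [/ltW h|_]; last by rewrite mulr0 sqr_ge0.
by rewrite mulr1 -[leRHS]real_normK ?num_real // lerXn2r ?nnegrE // ltW.
Qed.

(** After half of the noise, the points where the derivative along bit [i]
    exceeds [theta] form a set whose size is controlled by the influence of [i];
    the second half of the noise leaves this set.  The gradient bound makes the
    sum over the bits converge. *)
Lemma sum_derivative_fourth_moment f sigma theta kappa K j :
  0 <= sigma <= 1 -> 0 < theta -> 0 <= kappa ->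
  (forall y, 0 <= f y <= 1) -> (1 - sigma) * lam ^+ 2 * K = 1 ->
  (sigma ^+ 2) ^+ (2 ^ j) <= p * (1 - p) ->
  (forall i, E (fun x => `|D i f x|) <= theta * kappa ^+ (4 * 2 ^ j)) ->
  \sum_i E (fun x => D i (T (fun=> sigma) (T (fun=> sigma) f)) x ^+ 4) <=
  2 * theta ^+ 2 * K + 2 * kappa / theta ^+ 2 * K.
Proof.
move=> s01 t0 k0 f01 K1 sv Jf; have /andP[s0 s1] := s01.
have rs := rates_cst (n := n) s01.
pose u' := T (fun=> sigma) f; pose u := T (fun=> sigma) u'.
have u'01 y : 0 <= u' y <= 1 by exact: noise_itv.
have u01 y : 0 <= u y <= 1 by exact: noise_itv.
have c0 : 0 < (1 - sigma) * lam ^+ 2.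
  have c00 : 0 <= (1 - sigma) * lam ^+ 2 by rewrite mulr_ge0 ?subr_ge0 ?sqr_ge0.
  rewrite lt_neqAle c00 andbT eq_sym.
  by apply: contra_eqN K1 => /eqP ->; rewrite mul0r eq_sym oner_eq0.
have grad g x : (forall y, 0 <= g y <= 1) -> \sum_i D i (T (fun=> sigma) g) x ^+ 2 <= K.
  move=> g01; rewrite -(ler_pM2l c0) K1; apply: gradient_bound => // y.
  by rewrite ger0_norm; case/andP: (g01 y).
pose A i := indicator (fun x => theta < `|D i u' x|).
have A_small i : E (A i) <= kappa ^+ (4 * 2 ^ j).
  rewrite -(ler_pM2l t0); apply: le_trans (Jf i).
  apply: le_trans (markov_indicator _ t0) _.
  rewrite -[leRHS](expect_noise p (fun=> sigma)); apply: (le_expect lam_gt0 p_lam) => x.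
  rewrite /u' derivative_noise normrM (ger0_norm s0).
  apply: le_trans (noise_norm lam_gt0 p_lam _ _ rs).
  by rewrite ler_piMl.
have sigma2 : 0 <= sigma ^+ 2 <= 1 by rewrite exprn_ge0 // expr_le1.
have E1 i : E (fun x => D i u x ^+ 4) <=
    2 * theta ^+ 2 * E (fun x => D i u x ^+ 2) +
    2 * kappa / theta ^+ 2 * E (fun x => D i u' x ^+ 2).
  apply: (@le_trans _ _ (2 * theta ^+ 2 * E (fun x => D i u x ^+ 2) +
     2 * E (fun x => T (fun=> sigma) (A i) x ^+ 2))).
    rewrite -!expectZ -expectD; apply: (le_expect lam_gt0 p_lam) => x.
    have d1 : `|D i u x| <= 1 by exact: derivative_itv.
    have dt : `|D i u x| <= theta + T (fun=> sigma) (A i) x.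
      rewrite /u derivative_noise normrM (ger0_norm s0).
      apply: (@le_trans _ _ (T (fun=> sigma) (fun y => `|D i u' y|) x)).
        apply: le_trans (noise_norm lam_gt0 p_lam _ _ rs).
        by rewrite ler_piMl.
      rewrite -[theta in leRHS](noise_cst p (fun=> sigma) theta x) -noiseD.
      apply: (noise_le lam_gt0 p_lam) => // y; rewrite /A /indicator.
      case: ltP => h; last by rewrite addr0.
      by rewrite (le_trans (derivative_itv i y u'01)) // lerDr ltW.
    rewrite -[D i u x ^+ 2]real_normK ?num_real //.
    have -> : D i u x ^+ 4 = `|D i u x| ^+ 2 * `|D i u x| ^+ 2.
      by rewrite real_normK ?num_real // -exprD.
    have := normr_ge0 (D i u x); move: (`|D i u x|) (T _ _ x) d1 dt => {}d t d1 dt d0.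
    have d21 : d ^+ 2 <= 1 by rewrite expr_le1.
    have dd : d ^+ 2 <= 2 * theta ^+ 2 + 2 * t ^+ 2.
      apply: (@le_trans _ _ ((theta + t) ^+ 2)).
        by rewrite lerXn2r ?nnegrE // (le_trans d0).
      by have := sqr_ge0 (theta - t); lra.
    have d20 := sqr_ge0 d.
    apply: le_trans (ler_wpM2l d20 dd) _.
    rewrite mulrDr; apply: lerD; first by rewrite mulrC.
    by rewrite -[leRHS]mul1r ler_wpM2r // mulr_ge0 ?sqr_ge0.
  rewrite lerD2l -!mulrA ler_wpM2l // -stay_in_sqr.
  apply: le_trans (small_set_expansion sigma2 sv k0 (A_small i)) _.
  rewrite ler_wpM2l // -(ler_pM2l (exprn_gt0 2 t0)) mulrA mulfV ?mul1r.
    exact: chebyshev_indicator.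
  by rewrite expf_neq0 // gt_eqF.
apply: le_trans (ler_sum _ (fun i _ => E1 i)) _.
rewrite big_split -!big_distrr /= -!expect_sum.
have EK g : (forall y, 0 <= g y <= 1) ->
    E (fun x => \sum_i D i (T (fun=> sigma) g) x ^+ 2) <= K.
  move=> g01; rewrite -[leRHS](expect_cst n p); apply: (le_expect lam_gt0 p_lam).
  by move=> x; exact: grad.
apply: lerD; (rewrite ler_wpM2l; last exact: EK) => //.
  by rewrite mulr_ge0 ?sqr_ge0.
by rewrite !mulr_ge0 ?invr_ge0 ?sqr_ge0.
Qed.

(** Bessel's inequality, which is the lower variance bound at rate 0. *)
Lemma sum_mean_derivative_sqr f : (forall y, 0 <= f y <= 1) ->
  lam ^+ 2 * \sum_i E (D i f) ^+ 2 <= 1.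
Proof.
move=> f01; have r00 : 0 <= (0 : R) <= 1 by rewrite lexx ler01.
have := variance_ge_all lam_gt0 p_lam f [ffun=> true] r00.
rewrite subr0 mul1r; under eq_bigr do rewrite expect_noise0.
move/le_trans; apply; rewrite /variance !expect_noise0 lerBlDr.
apply: (@le_trans _ _ 1); last by rewrite lerDl sqr_ge0.
rewrite -[leRHS](expect_cst n p); apply: (le_expect lam_gt0 p_lam) => y.
by have /andP[f0 f1] := f01 y; rewrite expr_le1.
Qed.

End SmallSets.
(** The constants of [sum_derivative_fourth_moment] chosen for a given error:
    first the truncation level, then the size allowed for the small sets. *)
Lemma small_derivative_fourth_moment (R : realType) (lam sigma eps : R) :
  0 < lam -> 0 <= sigma < 1 -> 0 < eps ->
  exists2 eta, 0 < eta & forall n p (f : cube n -> R), lam <= p <= 1 - lam ->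
    (forall y, 0 <= f y <= 1) ->
    (forall i, expect p (fun x => `|discrete_derivative i f x|) <= eta) ->
    \sum_i expect p (fun x => discrete_derivative i
       (noise p (fun=> sigma) (noise p (fun=> sigma) f)) x ^+ 4) <= eps.
Proof.
move=> lam0 /andP[s0 s1] eps0.
pose K := ((1 - sigma) * lam ^+ 2)^-1.
have c0 : 0 < (1 - sigma) * lam ^+ 2 by rewrite mulr_gt0 ?subr_gt0 ?exprn_gt0.
have K0 : 0 < K by rewrite invr_gt0.
pose theta := Num.min 1 (eps / (4 * K)).
have t0 : 0 < theta by rewrite lt_min ltr01 divr_gt0 ?mulr_gt0.
pose kappa := eps * theta ^+ 2 / (4 * K).
have k0 : 0 < kappa by rewrite divr_gt0 ?mulr_gt0 ?exprn_gt0.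
have [j sj] : exists j, (sigma ^+ 2) ^+ (2 ^ j) <= lam ^+ 2.
  have s2 : `|sigma| < 1 by rewrite ger0_norm.
  have /cvgrPdist_lt/(_ lam lam0)[j _ /(_ j (leqnn j))] := cvg_expr s2.
  rewrite /= sub0r normrN normrX ger0_norm // => sj; exists j.
  rewrite -exprM mulnC exprM lerXn2r ?nnegrE ?exprn_ge0 ?(ltW lam0) //.
  apply: le_trans (ltW sj); rewrite ler_wiXn2l ?(ltW s1) //.
  exact/ltnW/ltn_expl.
exists (theta * kappa ^+ (4 * 2 ^ j)); first by rewrite mulr_gt0 // exprn_gt0.
move=> n p f p_lam f01 Jf.
have s01 : 0 <= sigma <= 1 by rewrite s0 ltW.
have K1 : (1 - sigma) * lam ^+ 2 * K = 1 by rewrite /K divff // gt_eqF.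
have sv : (sigma ^+ 2) ^+ (2 ^ j) <= p * (1 - p).
  apply: le_trans sj _; case/andP: p_lam => p1 p2.
  by rewrite expr2 ler_pM ?(ltW lam0) //; lra.
apply: le_trans (sum_derivative_fourth_moment lam0 p_lam s01 t0 (ltW k0) f01 K1 sv Jf) _.
have h1 : theta ^+ 2 * K <= eps / 4.
  apply: (@le_trans _ _ (theta * K)).
    by rewrite expr2 ler_pM2r // ler_piMr ?(ltW t0) // ge_min lexx.
  rewrite -ler_pdivlMr // -mulrA -invfM ge_min lexx orbT //.
have h2 : kappa / theta ^+ 2 * K = eps / 4.
  rewrite /kappa; field.
  by rewrite !gt_eqF.
have -> : 2 * theta ^+ 2 * K + 2 * kappa / theta ^+ 2 * K =
  2 * (theta ^+ 2 * K) + 2 * (kappa / theta ^+ 2 * K) by ring.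
by rewrite h2; lra.
Qed.
(** * Paths of a finite reversible Markov chain *)

Section ReversibleChain.
Variables (R : realFieldType) (S : finType) (d : S).
Variables (pi : S -> R) (Q : S -> S -> R).
Hypothesis pi_ge0 : forall x, 0 <= pi x.
Hypothesis Q_ge0 : forall x y, 0 <= Q x y.
Hypothesis Q_sum : forall x, \sum_y Q x y = 1.
Hypothesis Q_rev : forall x y, pi x * Q x y = pi y * Q y x.
Implicit Types (N j w : nat) (x y : S) (l : seq S) (F G : seq S -> R)
  (g : S -> R) (f : S -> bool).

Fixpoint path_weight x l : R :=
  if l is y :: l' then Q x y * path_weight y l' else 1.

Definition seq_weight l : R := if l is x :: l' then pi x * path_weight x l' else 0.

Definition chain_mean N F : R := \sum_(t : N.+1.-tuple S) seq_weight t * F t.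

Definition chain_prob N (B : pred (seq S)) := chain_mean N (fun l => (B l)%:R).

(** The mean given the starting point.  Its recursion on the first step makes
    the Markov property an induction, whereas [chain_mean] sums over whole paths
    and makes the reversal of time a reindexing. *)
Fixpoint walk_mean N F x : R :=
  if N is N'.+1 then \sum_y Q x y * walk_mean N' (fun l => F (x :: l)) y
  else F [:: x].

Definition transition g x := \sum_y Q x y * g y.

Lemma sum_tuple_cons N (G : seq S -> R) :
  \sum_(t : N.+1.-tuple S) G t = \sum_x \sum_(t : N.-tuple S) G (x :: t).
Proof.
rewrite pair_big /= (reindex (fun xt : S * N.-tuple S => [tuple of xt.1 :: xt.2])) //=.
exists (fun t : N.+1.-tuple S => (thead t, [tuple of behead t])).
  by move=> [x t] _ /=; rewrite theadE; congr (_, _); apply/val_inj.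
by move=> t _; rewrite /= [RHS]tuple_eta.
Qed.

Lemma sum_tuple0 (G : seq S -> R) : \sum_(t : 0.-tuple S) G t = G [::].
Proof.
rewrite (big_pred1 [tuple]) //= => t.
by apply/esym/eqP; rewrite !tuple0.
Qed.

Lemma walk_meanE N F x :
  walk_mean N F x = \sum_(t : N.-tuple S) path_weight x t * F (x :: t).
Proof.
elim: N F x => [|N IH] F x /=.
  by rewrite (sum_tuple0 (fun t => path_weight x t * F (x :: t))) /= mul1r.
rewrite (sum_tuple_cons N (fun t => path_weight x t * F (x :: t))) /=.
apply: eq_bigr => y _; rewrite IH big_distrr; apply: eq_bigr => t _ /=.
by rewrite mulrA.
Qed.

Lemma chain_meanE N F : chain_mean N F = \sum_x pi x * walk_mean N F x.
Proof.
rewrite /chain_mean (sum_tuple_cons N (fun t => seq_weight t * F t)) /=.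
apply: eq_bigr => x _; rewrite walk_meanE big_distrr; apply: eq_bigr => t _ /=.
by rewrite mulrA.
Qed.

Lemma eq_walk N F G x : (forall l, size l = N.+1 -> F l = G l) ->
  walk_mean N F x = walk_mean N G x.
Proof.
elim: N F G x => [|N IH] F G x FG /=; first exact: FG.
apply: eq_bigr => y _; congr (_ * _); apply: IH => l sl.
by apply: FG; rewrite /= sl.
Qed.

Lemma eq_chain N F G : (forall l, size l = N.+1 -> F l = G l) ->
  chain_mean N F = chain_mean N G.
Proof. by move=> FG; apply: eq_bigr => t _; rewrite FG // size_tuple. Qed.

Lemma path_weight_ge0 x l : 0 <= path_weight x l.
Proof. by elim: l x => [|y l IH] x /=; rewrite ?ler01 // mulr_ge0. Qed.

Lemma seq_weight_ge0 l : 0 <= seq_weight l.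
Proof. by case: l => [|x l] /=; rewrite ?lexx // mulr_ge0 ?path_weight_ge0. Qed.

Lemma chain_le N F G : (forall l, size l = N.+1 -> F l <= G l) ->
  chain_mean N F <= chain_mean N G.
Proof.
by move=> FG; apply: ler_sum => t _; rewrite ler_wpM2l ?seq_weight_ge0 ?FG ?size_tuple.
Qed.

Lemma chainD N F G :
  chain_mean N (fun l => F l + G l) = chain_mean N F + chain_mean N G.
Proof. by rewrite -big_split; apply: eq_bigr => t _; rewrite mulrDr. Qed.

Lemma chainZ N c F : chain_mean N (fun l => c * F l) = c * chain_mean N F.
Proof. by rewrite /chain_mean big_distrr; apply: eq_bigr => t _ /=; rewrite mulrCA. Qed.

Lemma chain_sum (I : Type) (r : seq I) (P : pred I) N (H : I -> seq S -> R) :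
  chain_mean N (fun l => \sum_(i <- r | P i) H i l) =
  \sum_(i <- r | P i) chain_mean N (H i).
Proof.
rewrite /chain_mean exchange_big /=; apply: eq_bigr => t _.
by rewrite big_distrr.
Qed.

Lemma walk_cst N c x : walk_mean N (fun=> c) x = c.
Proof.
elim: N x => [//|N IH] x /=; under eq_bigr do rewrite IH.
by rewrite -big_distrl /= Q_sum mul1r.
Qed.

Lemma walk_take M N F x : (M <= N)%N ->
  walk_mean N (fun l => F (take M.+1 l)) x = walk_mean M F x.
Proof.
elim: N M F x => [|N IH] [|M] F x //= MN.
  rewrite -[RHS]mul1r -(Q_sum x) big_distrl; apply: eq_bigr => y _ /=.
  rewrite -[in RHS](walk_cst N (F [:: x]) y); congr (_ * _).
  by apply: eq_walk => l _; rewrite take0.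
by apply: eq_bigr => y _; rewrite (IH M (fun l => F (x :: l))).
Qed.

Lemma chain_take M N F : (M <= N)%N ->
  chain_mean N (fun l => F (take M.+1 l)) = chain_mean M F.
Proof.
by move=> MN; rewrite !chain_meanE; apply: eq_bigr => x _; rewrite walk_take.
Qed.

Lemma walk_last w g x :
  walk_mean w (fun l => g (nth d l w)) x = iter w transition g x.
Proof.
elim: w x => [//|w IH] x; rewrite iterS /=.
by apply: eq_bigr => y _; rewrite -IH.
Qed.

Lemma walk_markov j w (H : seq S -> S -> R) x :
  walk_mean (j + w) (fun l => H (take j.+1 l) (nth d l (j + w))) x =
  walk_mean j (fun l => iter w transition (H l) (nth d l j)) x.
Proof.
elim: j H x => [|j IH] H x /=.
  rewrite add0n; case: w => [//|w] /=.
  apply: eq_bigr => y _; congr (_ * _); rewrite -walk_last.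
  by apply: eq_walk => l _; rewrite take0.
apply: eq_bigr => y _; congr (_ * _).
exact: (IH (fun l => H (x :: l))).
Qed.

Lemma stationary g : \sum_x pi x * transition g x = \sum_x pi x * g x.
Proof.
transitivity (\sum_y \sum_x pi y * Q y x * g y); last first.
  by apply: eq_bigr => y _; rewrite -big_distrl -big_distrr /= Q_sum mulr1.
rewrite exchange_big; apply: eq_bigr => x _; rewrite big_distrr /=.
by apply: eq_bigr => y _; rewrite mulrA Q_rev.
Qed.

Lemma chain_behead N F : chain_mean N.+1 (fun l => F (behead l)) = chain_mean N F.
Proof. by rewrite !chain_meanE /= -[RHS]stationary. Qed.

Lemma chain_drop N j F : chain_mean (N + j) (fun l => F (drop j l)) = chain_mean N F.
Proof.
elim: j F => [|j IH] F.
  by rewrite addn0; apply: eq_chain => l _; rewrite drop0.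
rewrite addnS -IH -[RHS]chain_behead; apply: eq_chain => l _.
by rewrite -[behead l]drop1 drop_drop addn1.
Qed.

Lemma seq_weight_rcons x l y :
  seq_weight (rcons (x :: l) y) = seq_weight (x :: l) * Q (last x l) y.
Proof.
rewrite /= -mulrA; congr (_ * _).
by elim: l x => [|z l IH] x /=; rewrite ?mulr1 ?mul1r // IH mulrA.
Qed.

Lemma seq_weight_rev l : seq_weight (rev l) = seq_weight l.
Proof.
case: l => // x l; elim: l x => [//|y l IH] x.
rewrite rev_cons; case E: (rev (y :: l)) => [|z m].
  by have := size_rev (y :: l); rewrite E.
rewrite seq_weight_rcons -E IH.
have -> : last z m = y.
  by have := last_rcons z (rev l) y; rewrite -rev_cons E.
by rewrite /= mulrAC -Q_rev mulrA.
Qed.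

Lemma chain_rev N F : chain_mean N (fun l => F (rev l)) = chain_mean N F.
Proof.
have revK_tuple : involutive (fun t : N.+1.-tuple S => [tuple of rev t]).
  by move=> t; apply/val_inj; rewrite /= revK.
rewrite /chain_mean [RHS](reindex_inj (inv_inj revK_tuple)) /=.
by apply: eq_bigr => t _; rewrite seq_weight_rev.
Qed.

End ReversibleChain.
(** * Changes of a Boolean sequence on nested grids *)

Section CountingChanges.
Local Open Scope nat_scope.
Implicit Types (g h : nat -> bool) (s : nat -> nat) (a b c i j w A B : nat).

Definition changes g a b : nat := \sum_(a <= j < b) (g j != g j.+1).

Definition coarse_changes A B g : nat :=
  \sum_(i < A) (g (i * B) != g (i.+1 * B)).

Definition refines A B g : bool := coarse_changes A B g < changes g 0 (A * B).

Lemma changes_cat g a b c : a <= b -> b <= c ->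
  changes g a c = changes g a b + changes g b c.
Proof. by move=> ab bc; rewrite /changes (big_cat_nat ab bc). Qed.

Lemma diff_le_changes g a b : a <= b -> (g a != g b) <= changes g a b.
Proof.
move=> /subnK <-; elim: (b - a) => [|k IH]; first by rewrite eqxx.
rewrite /changes addSn big_nat_recr ?leq_addl //= -/(changes g a (k + a)).
apply: leq_trans (_ : (g a != g (k + a)) + (g (k + a) != g (k + a).+1) <= _).
  by case: (g a); case: (g (k + a)); case: (g _.+1).
by rewrite leq_add2r.
Qed.

Lemma sub_grid_changes g s A : (forall i, s i <= s i.+1) ->
  \sum_(i < A) (g (s i) != g (s i.+1)) <= changes g (s 0) (s A).
Proof.
move=> smono; have s0 i : s 0 <= s i by elim: i => // i; move/leq_trans; apply.
elim: A => [|A IH]; first by rewrite big_ord0.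
rewrite big_ord_recr (changes_cat _ (s0 A) (smono A)) /=.
by apply: leq_add => //; exact: diff_le_changes.
Qed.

Lemma changes_cells g A B :
  changes g 0 (A * B) = \sum_(i < A) changes g (i * B) (i.+1 * B).
Proof.
elim: A => [|A IH]; first by rewrite big_ord0 /changes big_geq.
by rewrite big_ord_recr -IH (changes_cat _ (leq0n (A * B))) // leq_mul2r leqnSn orbT.
Qed.

(** Within one cell the coarse grid sees at most one change, so a return to the
    initial value inside a cell is lost on it. *)
Lemma double_change_refines g A B i j w : i < A ->
  i * B <= j -> j.+1 + w <= i.+1 * B ->
  g j != g j.+1 -> g j.+1 != g (j.+1 + w) -> refines A B g.
Proof.
move=> iA ij jw g1 g2; have iB k : k * B <= k.+1 * B by rewrite leq_mul2r leqnSn orbT.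
rewrite /refines /coarse_changes changes_cells.
rewrite (bigD1 (Ordinal iA)) //= [ltnRHS](bigD1 (Ordinal iA)) //= -addSn.
apply: leq_add; last by apply: leq_sum => k _; exact: diff_le_changes.
have jw' : j.+1 <= i.+1 * B by apply: leq_trans jw; exact: leq_addr.
rewrite (changes_cat _ (leq_trans ij (leqnSn j)) jw').
rewrite (changes_cat _ ij (leqnSn j)) (changes_cat _ (leq_addr w j.+1) jw).
have h1 := diff_le_changes g ij; have h2 := diff_le_changes g (leqnSn j).
have h3 := diff_le_changes g (leq_addr w j.+1); have h4 := diff_le_changes g jw.
apply: leq_trans (leq_add (leq_add h1 h2) (leq_add h3 h4)).
by move: g1 g2; case: (g j); case: (g j.+1); case: (g (j.+1 + w)); case: (g (i * B));
  case: (g (i.+1 * B)).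
Qed.

Lemma change_between g a b : a <= b -> g a != g b ->
  exists2 j, a <= j < b & g j != g j.+1.
Proof.
move=> ab gab; have := diff_le_changes g ab; rewrite gab => h.
have [/hasP[j]|] := boolP (has (fun j => g j != g j.+1) (index_iota a b)).
  by rewrite mem_index_iota => jab gj; exists j.
move/hasPn => H; move: h; rewrite /changes big_seq big1 // => j /H.
by rewrite negbK => /eqP ->; rewrite eqxx.
Qed.

Lemma eq_changes g h a b : (forall j, j <= b -> g j = h j) ->
  changes g a b = changes h a b.
Proof.
move=> gh; rewrite /changes big_nat [RHS]big_nat; apply: eq_bigr => j /andP[_ jb].
by rewrite !gh // ltnW.
Qed.

End CountingChanges.
(** * Changes of a function along a reversible chain *)

Section JumpsOfTheChain.
Variables (R : realFieldType) (S : finType) (d : S).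
Variables (pi : S -> R) (Q : S -> S -> R).
Hypothesis pi_ge0 : forall x, 0 <= pi x.
Hypothesis Q_ge0 : forall x y, 0 <= Q x y.
Hypothesis Q_sum : forall x, \sum_y Q x y = 1.
Hypothesis Q_rev : forall x y, pi x * Q x y = pi y * Q y x.
Variable f : S -> bool.
Implicit Types (N j w A B : nat) (x y : S) (l : seq S) (U V : pred (seq S)).

Local Notation mean := (chain_mean pi Q).
Local Notation prob := (chain_prob pi Q).
Local Notation step := (transition Q).

Definition trace l j := f (nth d l j).

(** The probability that [f] holds [w] steps after the chain is at [x]. *)
Definition forecast w x : R := iter w step (fun y => (f y)%:R) x.

Definition surprising w l j :=
  (trace l j != trace l j.+1) &&
  (3^-1 <= `|forecast w (nth d l j.+1) - (trace l j.+1)%:R|).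

Definition return_after w l j :=
  (trace l j != trace l j.+1) && (trace l j.+1 != trace l (j.+1 + w)).

Lemma prob_le N U V : (forall l, size l = N.+1 -> U l -> V l) ->
  prob N U <= prob N V.
Proof.
move=> UV; apply: chain_le => // l sl; rewrite ler_nat.
by have := UV l sl; case: (U l) => // ->.
Qed.

Lemma prob_or N U V : prob N (fun l => U l || V l) <= prob N U + prob N V.
Proof.
rewrite /chain_prob -chainD; apply: chain_le => // l _.
by rewrite -natrD ler_nat; case: (U l); case: (V l).
Qed.

Lemma prob_exists N m (U : nat -> pred (seq S)) :
  prob N (fun l => [exists j : 'I_m, U j l]) <= \sum_(j < m) prob N (U j).
Proof.
rewrite /chain_prob -chain_sum; apply: chain_le => // l _.
case: existsP => [[j Uj]|_]; last by rewrite sumr_ge0.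
by rewrite (bigD1 j) //= Uj lerDl sumr_ge0.
Qed.

Lemma iter_stepD w g h x :
  iter w step (fun y => g y + h y) x = iter w step g x + iter w step h x.
Proof.
elim: w x => [//|w IH] x; rewrite !iterS /transition -big_split /=.
by apply: eq_bigr => y _; rewrite IH mulrDr.
Qed.

Lemma iter_stepZ w c g x : iter w step (fun y => c * g y) x = c * iter w step g x.
Proof.
elim: w x => [//|w IH] x; rewrite !iterS /transition big_distrr /=.
by apply: eq_bigr => y _; rewrite IH mulrCA.
Qed.

Lemma iter_step_cst w c x : iter w step (fun=> c) x = c.
Proof.
elim: w x => [//|w IH] x; rewrite iterS /transition.
by under eq_bigr do rewrite IH; rewrite -big_distrl /= Q_sum mul1r.
Qed.

Lemma eq_iter_step w g h x : (forall y, g y = h y) -> iter w step g x = iter w step h x.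
Proof.
by move=> gh; elim: w x => [//|w IH] x; rewrite !iterS; apply: eq_bigr => y _; rewrite IH.
Qed.

Lemma iter_step_itv w g x : (forall y, 0 <= g y <= 1) -> 0 <= iter w step g x <= 1.
Proof.
move=> g01; elim: w x => [//|w IH] x; rewrite iterS; apply/andP; split.
  by apply: sumr_ge0 => y _; rewrite mulr_ge0 //; case/andP: (IH y).
rewrite -[leRHS](Q_sum x); apply: ler_sum => y _.
by rewrite -[leRHS]mulr1 ler_wpM2l //; case/andP: (IH y).
Qed.

Lemma forecast_dist w x :
  iter w step (fun y => (f x != f y)%:R) x = `|forecast w x - (f x)%:R|.
Proof.
have /andP[u0 u1] : 0 <= forecast w x <= 1.
  by apply: iter_step_itv => y; rewrite ler0n lern1 leq_b1.
case: (f x).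
  rewrite ler0_norm ?subr_le0 // opprB /forecast.
  rewrite -[X in X - _](iter_step_cst w 1 x) -[- iter _ _ _ _]mulN1r -iter_stepZ -iter_stepD.
  by apply: eq_iter_step => y; case: (f y) => /=; rewrite ?mulr1 ?subrr ?mulr0 ?addr0.
by rewrite subr0 ger0_norm //; apply: eq_iter_step => y; case: (f y).
Qed.

(** Markov property at the first surprising change: given the past, the
    probability of a return at lag [w] is the distance between the forecast and
    the new value, hence at least one third. *)
Lemma surprising_le_return N w :
  prob N (fun l => [exists j : 'I_(N - w), surprising w l j]) <=
  3 * prob N (fun l => [exists j : 'I_(N - w), return_after w l j]).
Proof.
(* Having the first surprising change at [j] depends on the path up to time
   [j.+1] only. *)
pose first l j := surprising w l j && [forall i : 'I_j, ~~ surprising w l i].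
have first_uniq l i j : first l i -> first l j -> i = j.
  move=> /andP[si /forallP ni] /andP[sj /forallP nj].
  have [ij|ji|//] := ltngtP i j.
    by have := nj (Ordinal ij); rewrite si.
  by have := ni (Ordinal ji); rewrite sj.
have first_ex m l : [exists j : 'I_m, surprising w l j] -> exists j : 'I_m, first l j.
  case/existsP => j0 sj0.
  have [j sj jmin] := @arg_minnP _ j0 (fun j : 'I_m => surprising w l j) val sj0.
  exists j; rewrite /first sj; apply/forallP => i; apply/negP => si.
  have im : (i < m)%N by apply: ltn_trans (ltn_ord i) _.
  by have := jmin (Ordinal im) si; rewrite /= leqNgt ltn_ord.
pose returns l j := trace l j.+1 != trace l (j.+1 + w).
apply: (@le_trans _ _ (\sum_(j < N - w) prob N (fun l => first l j))).
  rewrite -chain_sum; apply: chain_le => // l _.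
  case E: [exists j, _]; last by rewrite sumr_ge0.
  by have [j fj] := first_ex _ _ E; rewrite (bigD1 j) //= fj lerDl sumr_ge0.
apply: (@le_trans _ _ (\sum_(j < N - w) (3 * prob N (fun l => first l j && returns l j)))).
  apply: ler_sum => j _.
  have jN : (j.+1 + w <= N)%N by have := ltn_ord j; lia.
  have first_take l : first (take j.+2 l) j = first l j.
    have tr k : (k <= j.+1)%N -> nth d (take j.+2 l) k = nth d l k.
      by move=> kj; rewrite nth_take.
    have st k : (k <= j)%N -> surprising w (take j.+2 l) k = surprising w l k.
      by move=> kj; rewrite /surprising /trace !tr // ltnW.
    by rewrite /first st //; congr (_ && _); apply: eq_forallb => i; rewrite st // ltnW.
  rewrite /chain_prob.
  pose H l y : R := (first l j)%:R * (f (nth d l j.+1) != f y)%:R.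
  have -> : mean N (fun l => (first l j && returns l j)%:R) =
      mean (j.+1 + w) (fun l => H (take j.+2 l) (nth d l (j.+1 + w))).
    rewrite -(chain_take pi Q_sum _ jN); apply: eq_chain => // l sl.
    rewrite /H take_takel; last by rewrite ltnS leq_addr.
    by rewrite first_take !nth_take ?ltnS ?leq_addr // -natrM mulnb.
  rewrite addSn -addSn !chain_meanE.
  have -> : \sum_x pi x * walk_mean Q (j.+1 + w)
      (fun l => H (take j.+2 l) (nth d l (j.+1 + w))) x =
      mean j.+1 (fun l => iter w step (H l) (nth d l j.+1)).
    by rewrite chain_meanE; apply: eq_bigr => x _; rewrite walk_markov.
  have -> : \sum_x pi x * walk_mean Q N (fun l => (first l j)%:R) x =
      mean j.+1 (fun l => (first l j)%:R).
    rewrite -chain_meanE -(chain_take pi Q_sum _ (leq_trans (leq_addr w _) jN)).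
    by apply: eq_chain => // l sl; rewrite first_take.
  rewrite -chainZ; apply: chain_le => // l sl.
  rewrite /H iter_stepZ forecast_dist.
  case fj: (first l j); last by rewrite mul0r mulr0.
  by move: fj => /andP[/andP[_ sur] _]; rewrite mul1r -ler_pdivrMl ?mulr1.
rewrite -big_distrr /= ler_wpM2l // -chain_sum; apply: chain_le => // l sl.
have [/existsP[j fj]|] := boolP [exists j : 'I_(N - w), first l j].
  rewrite (bigD1 j) //= big1 ?addr0; last first.
    move=> i; rewrite -val_eqE => /eqP ij; case fi: (first l i) => //=.
    by case: ij; exact: first_uniq fi fj.
  rewrite fj ler_nat /=; case rj: (returns l j) => //.
  have /andP[/andP[sj _] _] := fj.
  by rewrite lt0b; apply/existsP; exists j; rewrite /return_after sj.
rewrite negb_exists => /forallP nf; rewrite big1 // => j _.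
by rewrite (negPf (nf j)).
Qed.

(** A return within [w.+1] steps lies inside a cell of the coarse grid or of
    its translate by half a cell; by stationarity both cost the same. *)
Lemma return_le_refines A B w : (w < B)%N ->
  prob (A * B.*2) (fun l => [exists j : 'I_(A * B.*2 - w), return_after w l j]) <=
  2 * prob (A * B.*2) (fun l => refines A B.*2 (trace l)).
Proof.
move=> wB; set N := (A * B.*2)%N.
have B0 : (0 < B.*2)%N by rewrite double_gt0 (leq_ltn_trans _ wB).
pose V l := refines A B.*2 (trace l).
pose W l := [exists j : 'I_(N - w), return_after w l j].
have key l : size l = (N + B).+1 -> W (take N.+1 l) ->
    V (take N.+1 l) || V (drop B l).
  move=> sl /existsP[[j jN]] /= /andP[].
  have jN' : (j.+1 + w <= N)%N by lia.
  rewrite /trace !nth_take ?ltnS //; try lia.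
  move=> h1 h2; have := divn_eq j B.*2; have := ltn_pmod j B0.
  set i := (j %/ B.*2)%N; set r := (j %% B.*2)%N => rB jE.
  have iA : (i < A)%N by rewrite /i ltn_divLR //; apply: leq_trans jN _; rewrite leq_subr.
  have cell : (i.+1 * B.*2 <= N)%N by rewrite leq_mul2r iA orbT.
  have [inside|outside] := leqP (r.+1 + w) B.*2.
    apply/orP; left; rewrite /V.
    apply: (@double_change_refines _ A B.*2 i j w) => //.
    - by rewrite jE leq_addr.
    - by rewrite mulSn; lia.
    - by rewrite /trace !nth_take // ltnS; lia.
    - by rewrite /trace !nth_take // ltnS; lia.
  apply/orP; right; rewrite /V.
  have Br : (B <= r)%N by lia.
  have Bj : (B <= j)%N by lia.
  apply: (@double_change_refines _ A B.*2 i (j - B) w) => //.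
  - by lia.
  - by rewrite mulSn; lia.
  - by rewrite /trace !nth_drop addnS subnKC.
  - by rewrite /trace !nth_drop addnA addnS subnKC.
rewrite {1}/prob -(chain_take pi Q_sum _ (leq_addr B N)).
apply: (@le_trans _ _ (prob (N + B) (fun l => V (take N.+1 l) || V (drop B l)))).
  by apply: (@prob_le (N + B) (fun l => W (take N.+1 l))) => l sl; exact: key.
apply: le_trans (prob_or _ _ _) _.
rewrite {1 2}/prob (chain_take pi Q_sum (fun l => (V l)%:R)) ?leq_addr //.
by rewrite (chain_drop Q_sum Q_rev _ B (fun l => (V l)%:R)) mulr2n mulrDl mul1r.
Qed.

Lemma chain_marginal j g : mean j (fun l => g (nth d l j)) = \sum_x pi x * g x.
Proof.
have -> : mean j (fun l => g (nth d l j)) =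
    mean (0 + j) (fun l => (fun l' => g (nth d l' 0)) (drop j l)).
  by apply: eq_chain => l _; rewrite nth_drop addn0.
by rewrite (chain_drop Q_sum Q_rev 0 j (fun l' => g (nth d l' 0))) chain_meanE.
Qed.

Lemma chain_pair N j w (h : S -> S -> R) : (j + w <= N)%N ->
  mean N (fun l => h (nth d l j) (nth d l (j + w))) =
  \sum_x pi x * iter w step (h x) x.
Proof.
move=> jN; rewrite -(chain_marginal j (fun x => iter w step (h x) x)).
pose H l y := h (nth d l j) y.
transitivity (mean (j + w) (fun l => H (take j.+1 l) (nth d l (j + w)))).
  rewrite -(chain_take pi Q_sum _ jN); apply: eq_chain => l sl.
  by rewrite /H !nth_take ?ltnS ?leq_addr.
by rewrite !chain_meanE; apply: eq_bigr => x _; rewrite walk_markov.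
Qed.

(** If the chain rarely returns, then at a change of [f] the forecasts made
    just before (in reversed time) and just after it disagree, so that the
    forecast jumps in a single step. *)
Lemma change_le_jumps A B w : (0 < A)%N -> (w.+1 < B)%N ->
  \sum_x pi x * iter (A * B.*2 - w.*2.+1) step (fun y => (f x != f y)%:R) x <=
  12 * prob (A * B.*2) (fun l => refines A B.*2 (trace l)) +
  (A * B.*2)%:R * (81 *
    \sum_x pi x * step (fun y => (forecast w y - forecast w.+1 x) ^+ 4) x).
Proof.
move=> A0 wB; set N := (A * B.*2)%N.
have NB : (B.*2 <= N)%N by rewrite leq_pmull.
have Nw : (w.+1 + (N - w.*2.+1) = N - w)%N by lia.
rewrite -(@chain_pair N w.+1 _ (fun x y => (f x != f y)%:R)); last by lia.
rewrite Nw.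
pose jump j l := 3^-1 <= `|forecast w (nth d l j.+1) - forecast w.+1 (nth d l j)|.
pose U1 l := [exists j : 'I_(N - w), surprising w l j].
pose U2 l := [exists j : 'I_(N - w.+1), surprising w.+1 l j].
pose U3 l := [exists j : 'I_N, jump j l].
have key l : size l = N.+1 -> trace l w.+1 != trace l (N - w) ->
    U1 l || (U2 (rev l) || U3 l).
  move=> sl; have wN : (w.+1 <= N - w)%N by lia.
  move=> /(change_between wN)[j /andP[wj jN] gj].
  have jN' : (j < N)%N by lia.
  have [lt1|ge1] := ltP `|forecast w (nth d l j.+1) - (trace l j.+1)%:R| 3^-1; last first.
    by apply/orP; left; apply/existsP; exists (Ordinal jN); rewrite /surprising gj.
  have [lt2|ge2] := ltP `|forecast w.+1 (nth d l j) - (trace l j)%:R| 3^-1; last first.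
    apply/orP; right; apply/orP; left; apply/existsP.
    (* In reversed time the change from [j] to [j.+1] is the one that starts at
       [N - j.+1]; its new state is the old one. *)
    have j' : (N - j.+1 < N - w.+1)%N by lia.
    exists (Ordinal j'); rewrite /surprising /trace !nth_rev ?sl /=; try lia.
    have -> : (N.+1 - (N - j.+1).+1 = j.+1)%N by lia.
    have -> : (N.+1 - (N - j.+1).+2 = j)%N by lia.
    by rewrite eq_sym gj.
  apply/orP; right; apply/orP; right; apply/existsP; exists (Ordinal jN').
  change (is_true (3^-1 <= `|forecast w (nth d l j.+1) - forecast w.+1 (nth d l j)|)).
  move: lt1 lt2 gj; rewrite /trace.
  move: (forecast _ _) (forecast _ _) => s t.
  rewrite !ltr_norml => /andP[s1 s2] /andP[t1 t2].
  case: (f (nth d l j)) s1 s2 t1 t2; case: (f _) => //= s1 s2 t1 t2 _;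
    rewrite ler_normr; apply/orP; first [left; lra | right; lra].
have prob_key : prob N (fun l => trace l w.+1 != trace l (N - w)) <=
    prob N U1 + (prob N (fun l => U2 (rev l)) + prob N U3).
  apply: le_trans (prob_le key) _; apply: le_trans (prob_or _ _ _) _.
  by rewrite lerD2l; exact: prob_or.
apply: le_trans prob_key _; rewrite addrA; apply: lerD.
  have -> : prob N (fun l => U2 (rev l)) = prob N U2.
    exact: (chain_rev Q_rev N (fun l => (U2 l)%:R)).
  have r1 := return_le_refines A (ltnW wB); have r2 := return_le_refines A wB.
  have s1 := surprising_le_return N w; have s2 := surprising_le_return N w.+1.
  rewrite -/N in r1 r2; rewrite -/U1 in s1; rewrite -/U2 in s2; lra.
apply: le_trans (prob_exists _ _ _) _.
rewrite mulr_natl -[X in _ *+ X](card_ord N) -sumr_const; apply: ler_sum => j _.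
rewrite -(@chain_pair N j 1 (fun x y => (forecast w y - forecast w.+1 x) ^+ 4)) ?addn1 //.
rewrite -chainZ; apply: chain_le => // l sl.
case jl: (jump j l); last by rewrite mulr_ge0 ?ler0n // (exprM _ 2 2) sqr_ge0.
move: jl; rewrite /jump; move: (_ - _) => t t3.
have t9 : 9^-1 <= t ^+ 2.
  rewrite -real_normK ?num_real //; have -> : 9^-1 = 3^-1 ^+ 2 :> R by field.
  by rewrite lerXn2r ?nnegrE ?invr_ge0 ?ler0n.
rewrite -ler_pdivrMl ?mulr1 ?ltr0n //; have -> : 81^-1 = 9^-1 ^+ 2 :> R by field.
by rewrite (exprM t 2 2) lerXn2r ?nnegrE ?invr_ge0 ?ler0n ?sqr_ge0.
Qed.

End JumpsOfTheChain.
(** * The law of the random walk on a grid *)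

Section FiniteRange.
Variables (R : realType) (d : measure_display) (T : measurableType d).
Variables (P : probability T R) (U : finType) (Y : T -> U).
Hypothesis Y_meas : forall u, measurable [set w | Y w = u].

Lemma finite_range_bigcup (B : pred U) :
  [set w | B (Y w)] = \bigcup_(u in [set` enum B]) [set w | Y w = u].
Proof.
apply/seteqP; split => [w /= BY|w [u /=]].
  by exists (Y w) => //=; rewrite mem_enum.
by rewrite mem_enum => Bu ->.
Qed.

Lemma measurable_finite_range (B : pred U) : measurable [set w | B (Y w)].
Proof.
by rewrite finite_range_bigcup; apply: fin_bigcup_measurable => //.
Qed.

Lemma probability_finite_range (B : pred U) :
  P [set w | B (Y w)] = (\sum_(u | B u) P [set w | Y w = u])%E.
Proof.
rewrite finite_range_bigcup measure_fin_bigcup //; last first.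
  apply/trivIsetP => u v _ _ uv; rewrite -subset0 => w [/= -> /eqP].
  by rewrite (negPf uv).
by rewrite -fsbig_seq ?enum_uniq // big_enum.
Qed.

End FiniteRange.

Lemma probability_subset_sum (R : realType) (d : measure_display)
    (T : measurableType d) (P : probability T R) (I : finType) (A : set T)
    (F : I -> set T) : (forall i, measurable (F i)) -> measurable A ->
  A `<=` \bigcup_i F i -> (P A <= \sum_i P (F i))%E.
Proof.
move=> mF mA AF.
have -> : (\sum_i P (F i) = \sum_(i \in [set` enum I]) P (F i))%E.
  by rewrite -fsbig_seq ?enum_uniq // big_enum.
apply: content_sub_fsum => // w /AF[i _ Fi].
by exists i => //=; rewrite mem_enum.
Qed.

Lemma sum_poisson_pmf_le1 (R : realType) (r : R) c : 0 < r ->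
  \sum_(k < c) poisson_pmf r k <= 1.
Proof.
move=> r0; rewrite /poisson_pmf r0 -big_distrl /=.
rewrite -[leRHS](expRxMexpNx_1 r) ler_wpM2r ?expR_ge0 //.
rewrite /expR; apply: le_trans (nondecreasing_cvgn_le _ _ c).
- by rewrite /series /= big_mkord.
- apply: nondecreasing_series => k _ _; exact: exp_coeff_ge0 (ltW r0).
- exact: is_cvg_series_exp_coeff.
Qed.
Section WalkLaw.
Variables (R : realType) (d : measure_display) (T : measurableType d).
Variables (P : probability T R) (p : R) (n : nat) (X : R -> T -> cube n).
Variables (K : 'I_n -> R -> T -> nat) (V : 'I_n -> nat -> T -> bool).
Hypothesis p01 : 0 < p < 1.
Hypothesis K_poisson : forall i, poisson_process_rate1 P (K i).
Hypothesis V_bernoulli : forall i k, measurable_fun setT (V i k) /\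
  (forall B : set bool, P (V i k @^-1` B) = bernoulli_prob p B).
Hypothesis KV_indep : mutually_independent P (fun j : 'I_n + 'I_n * nat =>
  match j with
  | inl i => sigma_process (K i)
  | inr ik => g_sigma_algebra_preimage (V ik.1 ik.2)
  end).
Hypothesis X_def : forall t : R, 0 <= t -> forall w i, X t w i = V i (K i t w) w.

Lemma measurable_clock i t k : 0 <= t -> measurable [set w | K i t w = k].
Proof.
move=> t0; have [mK _ _ _ _] := K_poisson i.
by have := mK t t0 measurableT [set k] I; rewrite setTI.
Qed.

Lemma measurable_value i k b : measurable [set w | V i k w = b].
Proof.
by have := (V_bernoulli i k).1 measurableT [set b] I; rewrite setTI.
Qed.

Lemma measurable_state t x : 0 <= t -> measurable [set w | X t w = x].
Proof.
move=> t0; rewrite (_ : mkset _ = \bigcap_(i in [set: 'I_n])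
    \bigcup_k ([set w | K i t w = k] `&` [set w | V i k w = x i])).
  apply: fin_bigcap_measurable => // i _; apply: bigcupT_measurable => k.
  by apply: measurableI; [exact: measurable_clock|exact: measurable_value].
apply/seteqP; split => [w /= <- i _|w /= Xw].
  by exists (K i t w) => //=; rewrite X_def.
by apply/ffunP => i; have [k _ [/= Kk <-]] := Xw i I; rewrite X_def // Kk.
Qed.

Variable N : nat.
Hypothesis N_gt0 : (0 < N)%N.

Definition grid_time (j : nat) : R := j%:R / N%:R.

Lemma grid_time_ge0 j : 0 <= grid_time j.
Proof. by rewrite divr_ge0 ?ler0n. Qed.

Lemma grid_time_mono j k : (j <= k)%N -> grid_time j <= grid_time k.
Proof. by move=> jk; rewrite ler_pM2r ?invr_gt0 ?ltr0n // ler_nat. Qed.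

Lemma grid_time_step j : grid_time j.+1 - grid_time j = N%:R^-1.
Proof. by rewrite /grid_time -mulrBl -natrB // subSnn mul1r. Qed.

Lemma grid_time0 : grid_time 0 = 0.
Proof. by rewrite /grid_time mul0r. Qed.

Definition rings (i : 'I_n) (j : nat) (w : T) : nat :=
  (K i (grid_time j.+1) w - K i (grid_time j) w)%N.

Lemma clock_sum_rings i j w :
  K i (grid_time j) w = (\sum_(l < j) rings i l w)%N.
Proof.
have [_ K0 Kpath _ _] := K_poisson i.
elim: j => [|j IH]; first by rewrite grid_time0 K0 big_ord0.
rewrite big_ord_recr /= -IH /rings subnKC //.
by apply: (Kpath w).1; [exact: grid_time_ge0|exact/grid_time_mono/leqnSn].
Qed.

Lemma sigma_process_rings i j k : sigma_process (K i) [set w | rings i j w = k].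
Proof.
have ev j' m : sigma_process (K i) [set w | K i (grid_time j') w = m].
  apply: sub_sigma_algebra; exists (grid_time j'); first exact: grid_time_ge0.
  by exists [set m] => //; rewrite setTI.
rewrite (_ : mkset _ = \bigcup_m ([set w | K i (grid_time j) w = m] `&`
    \bigcup_m' ([set w | K i (grid_time j.+1) w = m'] `&` [set _ | (m' - m)%N = k]))).
  apply: (@bigcupT_measurable _ (g_sigma_algebraType _)) => m.
  apply: (@measurableI _ (g_sigma_algebraType _)); first exact: ev.
  apply: (@bigcupT_measurable _ (g_sigma_algebraType _)) => m'.
  apply: (@measurableI _ (g_sigma_algebraType _)); first exact: ev.
  have [mk|mk] := eqVneq (m' - m)%N k.
    have -> : [set _ : T | (m' - m)%N = k] = setT by apply/seteqP; split.
    exact: measurableT.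
  have -> : [set _ : T | (m' - m)%N = k] = set0.
    by rewrite -subset0 => w /= /eqP; rewrite (negPf mk).
  exact: measurable0.
apply/seteqP; split => [w /= <-|w /=].
  by exists (K i (grid_time j) w) => //; split => //; exists (K i (grid_time j.+1) w).
by case=> m _ [/= <- [m' _ [/= <- <-]]].
Qed.

Lemma sigma_process_measurable i A : sigma_process (K i) A -> measurable A.
Proof.
move: A; apply: smallest_sub; first exact: sigma_algebra_measurable.
move=> A [t /= t0 [B _ <-]]; rewrite setTI.
by have [mK _ _ _ _] := K_poisson i; rewrite -[_ @^-1` _]setTI; exact: mK.
Qed.

Implicit Type D : 'I_n * 'I_N -> nat.

Definition rings_event D i := [set w | forall j : 'I_N, rings i j w = D (i, j)].

Lemma rings_eventE D i :
  rings_event D i = \bigcap_(j in [set` enum 'I_N]) [set w | rings i j w = D (i, j)].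
Proof.
apply/seteqP; split => [w /= H j _|w /= H j]; first exact: H.
by apply: H; rewrite /= mem_enum.
Qed.

Lemma sigma_process_rings_event D i : sigma_process (K i) (rings_event D i).
Proof.
rewrite rings_eventE.
apply: (@fin_bigcap_measurable _ (g_sigma_algebraType _)) => // j _.
exact: sigma_process_rings.
Qed.

Lemma measurable_rings_event D i : measurable (rings_event D i).
Proof. by apply: (@sigma_process_measurable i); exact: sigma_process_rings_event. Qed.

Lemma measurable_path_event (y : nat -> cube n) :
  measurable [set w | forall j, (j <= N)%N -> X (grid_time j) w = y j].
Proof.
rewrite (_ : mkset _ = \bigcap_(j in `I_N.+1) [set w | X (grid_time j) w = y j]).
  apply: fin_bigcap_measurable => // j _; apply: measurable_state.
  exact: grid_time_ge0.
by apply/seteqP; split => [w h j /= jN|w h j jN]; apply: h.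
Qed.

Lemma measurable_path_rings (y : nat -> cube n) D :
  measurable [set w | (forall j, (j <= N)%N -> X (grid_time j) w = y j) /\
              (forall i, rings_event D i w)].
Proof.
rewrite (_ : mkset _ =
    [set w | forall j, (j <= N)%N -> X (grid_time j) w = y j] `&`
    \bigcap_(i in [set: 'I_n]) rings_event D i).
  apply: measurableI; first exact: measurable_path_event.
  by apply: fin_bigcap_measurable => // i _; exact: measurable_rings_event.
apply/seteqP; split => [w [h1 h2]|w [h1 h2]]; split.
- exact: h1.
- by move=> i _; exact: h2.
- exact: h1.
- by move=> i; exact: h2.
Qed.

Lemma probability_rings i j k : P [set w | rings i j w = k] = (poisson_pmf N%:R^-1 k)%:E.
Proof.
have [_ _ _ _ Kp] := K_poisson i.
rewrite -(grid_time_step j) -Kp //; first exact: grid_time_ge0.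
by rewrite ltr_pM2r ?invr_gt0 ?ltr0n // ltr_nat.
Qed.

Lemma probability_rings_event D i :
  P (rings_event D i) = (\prod_(j < N) poisson_pmf N%:R^-1 (D (i, j)))%:E.
Proof.
have [_ _ _ indep _] := K_poisson i.
rewrite rings_eventE.
rewrite (indep N grid_time (grid_time_ge0 0) (fun j => grid_time_mono (leqnSn j))
  (enum 'I_N) (fun j => [set w | rings i j w = D (i, j)]) (enum_uniq _)).
  rewrite big_enum -prodEFin; apply: eq_bigr => j _; exact: probability_rings.
by move=> j _; exists [set D (i, j)] => //; rewrite setTI.
Qed.

Lemma probability_value i k b : P [set w | V i k w = b] = (bit_weight p b)%:E.
Proof.
have -> : [set w | V i k w = b] = V i k @^-1` [set b] by [].
rewrite (V_bernoulli i k).2 /bernoulli_prob.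
by case/andP: p01 => p0 p1; rewrite !ltW // fsbig_set1.
Qed.

(** The probability of passing from [a] to [b] given [k] rings: only the last
    draw counts. *)
Definition ring_weight k a b : R := if k == 0%N then (a == b)%:R else bit_weight p b.

(** On the event that the clocks ring as prescribed by [D], the path is
    determined by finitely many independent draws, one for each grid interval
    in which a clock rings. *)
Lemma probability_path_rings_le (y : nat -> cube n) D :
  (P [set w | (forall j, (j <= N)%N -> X (grid_time j) w = y j) /\
              (forall i, rings_event D i w)] <=
  ((\prod_i bit_weight p (y 0%N i)) *
   \prod_(ij : 'I_n * 'I_N) (poisson_pmf N%:R^-1 (D ij) *
      ring_weight (D ij) (y ij.2 ij.1) (y ij.2.+1 ij.1)))%:E)%E.
Proof.
set A := mkset _.
have [->|/set0P[w0 [Xw0 Dw0]]] := eqVneq A set0.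
  rewrite measure0 lee_fin mulr_ge0 ?prodr_ge0 // => i _.
    by rewrite /bit_weight; case: (y _ _); case/andP: p01 => ? ?; lra.
  rewrite mulr_ge0 ?poisson_pmf_ge0 // /ring_weight.
  case: eqP => _; first by rewrite ler0n.
  by rewrite /bit_weight; case: (y _ _); case/andP: p01 => ? ?; lra.
(* A witness of the event fixes the indices of the draws that are read, and
   the values that they must take. *)
pose c i (j : nat) := K i (grid_time j) w0.
have stateE w i j : A w -> (j <= N)%N -> y j i = V i (c i j) w.
  move=> [Xw Dw] jN; rewrite -Xw // X_def ?grid_time_ge0 //.
  congr V; rewrite /c !clock_sum_rings; apply: eq_bigr => l _.
  have lN : (l < N)%N by apply: leq_trans (ltn_ord l) _.
  by have := Dw i (Ordinal lN); have := Dw0 i (Ordinal lN) => /= -> ->.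
have Aw0 : A w0 by [].
have c0 i : c i 0%N = 0%N by rewrite /c grid_time0; have [_ ->] := K_poisson i.
have cS i (j : 'I_N) : c i j.+1 = (c i j + D (i, j))%N.
  by rewrite /c !clock_sum_rings big_ord_recr /= (Dw0 i j).
have cmono i j k : (j <= k)%N -> (k <= N)%N -> (c i j <= c i k)%N.
  move=> jk kN; have [_ _ Kpath _ _] := K_poisson i.
  by apply: (Kpath w0).1; [exact: grid_time_ge0|exact: grid_time_mono].
pose B (j : 'I_n + 'I_n * nat) : set T := match j with
  | inl i => rings_event D i
  | inr ik => [set w | V ik.1 ik.2 w = V ik.1 ik.2 w0] end.
pose s1 : seq ('I_n + 'I_n * nat) := [seq inl i | i <- enum 'I_n].
pose s2 : seq ('I_n + 'I_n * nat) := [seq inr (i, 0%N) | i <- enum 'I_n].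
pose L := [seq ij <- enum {: 'I_n * 'I_N} | D ij != 0%N].
pose s3 : seq ('I_n + 'I_n * nat) :=
  [seq inr (ij.1, c ij.1 ij.2.+1) | ij : 'I_n * 'I_N <- L].
have us : uniq (s1 ++ s2 ++ s3).
  rewrite !cat_uniq; apply/and3P; split.
  - by rewrite map_inj_uniq ?enum_uniq // => i i' [].
  - apply/hasPn => u; rewrite mem_cat => /orP[] /mapP[v _ ->];
      by apply/negP => /mapP[].
  apply/and3P; split.
  - by rewrite map_inj_uniq ?enum_uniq // => i i' [].
  - apply/hasPn => u /mapP[[i j]]; rewrite mem_filter => /andP[/= Dij _] ->.
    apply/negP => /mapP[i' _ [_ /eqP]].
    by rewrite cS addn_eq0 (negPf Dij) andbF.
  rewrite map_inj_in_uniq; first exact/filter_uniq/enum_uniq.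
  have lt_c i (j j' : 'I_N) : (j < j')%N -> D (i, j') != 0%N -> (c i j.+1 < c i j'.+1)%N.
    move=> jj' Dj'; rewrite [c i j'.+1]cS.
    apply: leq_ltn_trans (cmono i _ _ jj' (ltnW (ltn_ord j'))) _.
    by rewrite -[ltnLHS]addn0 ltn_add2l lt0n.
  move=> [i j] [i' j']; rewrite !mem_filter => /andP[/= Dj _] /andP[/= Dj' _] [ii'].
  move: Dj'; rewrite -ii' => Dj' cc; congr (_, _); apply/val_inj.
  have [jj'|jj'|//] := ltngtP j j'.
    by have := lt_c i _ _ jj' Dj'; rewrite cc ltnn.
  by have := lt_c i _ _ jj' Dj; rewrite cc ltnn.
have mA : measurable A by exact: measurable_path_rings.
have mB u : measurable (B u).
  case: u => [i|[i k]] /=; last exact: measurable_value.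
  exact: measurable_rings_event.
have AB : A `<=` \bigcap_(u in [set` s1 ++ s2 ++ s3]) B u.
  move=> w Aw u /=; rewrite !mem_cat => /or3P[] /mapP[].
  - by move=> i _ -> /=; exact: Aw.2.
  - by move=> i _ -> /=; rewrite -(c0 i) -!stateE.
  - by move=> [i j] _ -> /=; rewrite -!stateE.
have mcap : measurable (\bigcap_(u in [set` s1 ++ s2 ++ s3]) B u).
  by apply: fin_bigcap_measurable.
have PB := KV_indep us (A := B).
apply: (@le_trans _ _ (P (\bigcap_(u in [set` s1 ++ s2 ++ s3]) B u))).
  by apply: le_measure => //; exact: mem_set.
rewrite PB; last first.
  move=> [i|[i k]] _ /=; first exact: sigma_process_rings_event.
  by exists [set V i k w0] => //; rewrite setTI.
have e1 : (\prod_(u <- s1) P (B u) =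
    (\prod_i \prod_(j < N) poisson_pmf N%:R^-1 (D (i, j)))%:E)%E.
  rewrite big_map big_enum -prodEFin; apply: eq_bigr => i _.
  exact: probability_rings_event.
have e2 : (\prod_(u <- s2) P (B u) = (\prod_i bit_weight p (y 0%N i))%:E)%E.
  rewrite big_map big_enum -prodEFin; apply: eq_bigr => i _.
  by rewrite (stateE w0) // c0; exact: probability_value.
have e3 : (\prod_(u <- s3) P (B u) =
    (\prod_(ij : 'I_n * 'I_N) ring_weight (D ij) (y ij.2 ij.1) (y ij.2.+1 ij.1))%:E)%E.
  rewrite big_map big_filter big_enum_cond /= big_mkcond -prodEFin.
  apply: eq_bigr => -[i j] _ /=; rewrite /ring_weight.
  case: eqP => //= Dij; last by rewrite probability_value -stateE.
  rewrite !(stateE w0) // ?(ltnW (ltn_ord j)) //.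
  by rewrite cS Dij addn0 eqxx.
rewrite !big_cat /= e1 e2 e3 -!EFinM lee_fin.
rewrite pair_big /= mulrCA big_split /=.
rewrite le_eqVlt; apply/orP; left; apply/eqP; congr (_ * (_ * _)).
by apply: eq_bigr => -[].
Qed.

(** The probability that a clock does not ring during one grid step. *)
Definition hold_rate : R := expR (- N%:R^-1).

Lemma hold_rate01 : 0 <= hold_rate <= 1.
Proof. by rewrite expR_ge0 -expR0 ler_expR oppr_le0 invr_ge0 ler0n. Qed.

Lemma sum_ring_weight_le c a b :
  \sum_(k < c.+1) poisson_pmf N%:R^-1 k * ring_weight k a b <=
  bit_kernel p hold_rate a b.
Proof.
have N0 : 0 < N%:R^-1 :> R by rewrite invr_gt0 ltr0n.
have p0E : poisson_pmf N%:R^-1 0 = hold_rate :> R.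
  by rewrite /poisson_pmf N0 expr0 fact0 invr1 !mul1r.
rewrite big_ord_recl /= p0E /ring_weight /= /bit_kernel lerD2l -big_distrl /=.
apply: ler_wpM2r.
  by rewrite /bit_weight; case: b; case/andP: p01 => ? ?; lra.
by have := sum_poisson_pmf_le1 c.+1 N0; rewrite big_ord_recl /= p0E; lra.
Qed.

Definition path_prob (y : nat -> cube n) : R :=
  (\prod_i bit_weight p (y 0%N i)) *
  \prod_(ij : 'I_n * 'I_N) bit_kernel p hold_rate (y ij.2 ij.1) (y ij.2.+1 ij.1).

(** Summing over the numbers of rings, first bounded so that the sum is finite;
    an inequality is enough here because the total masses agree. *)
Lemma probability_path_le (y : nat -> cube n) :
  (P [set w | forall j, (j <= N)%N -> X (grid_time j) w = y j] <=
   (path_prob y)%:E)%E.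
Proof.
pose F c := \bigcup_(D : {ffun 'I_n * 'I_N -> 'I_c.+1})
  [set w | (forall j, (j <= N)%N -> X (grid_time j) w = y j) /\
           (forall i, rings_event (fun ij => D ij) i w)].
have mF c : measurable (F c).
  by apply: fin_bigcup_measurable => // D _; exact: measurable_path_rings.
have F_le c : (P (F c) <= (path_prob y)%:E)%E.
  pose G (D : {ffun 'I_n * 'I_N -> 'I_c.+1}) :=
    [set w | (forall j, (j <= N)%N -> X (grid_time j) w = y j) /\
             (forall i, rings_event (fun ij => D ij) i w)].
  have mG (D : {ffun 'I_n * 'I_N -> 'I_c.+1}) : measurable (G D)
    by exact: measurable_path_rings.
  have FG : F c `<=` \bigcup_(D : {ffun 'I_n * 'I_N -> 'I_c.+1}) G D by [].
  apply: le_trans (probability_subset_sum P mG (mF c) FG) _.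
  apply: (@le_trans _ _ (\sum_(D : {ffun 'I_n * 'I_N -> 'I_c.+1})
      ((\prod_i bit_weight p (y 0%N i)) *
       \prod_(ij : 'I_n * 'I_N) (poisson_pmf N%:R^-1 (D ij) *
         ring_weight (D ij) (y ij.2 ij.1) (y ij.2.+1 ij.1)))%:E)%E).
    by apply: lee_sum => D _; exact: probability_path_rings_le.
  rewrite sumEFin lee_fin -big_distrr /=; apply: ler_wpM2l.
    apply: prodr_ge0 => i _.
    by rewrite /bit_weight; case: (y _ _); case/andP: p01 => ? ?; lra.
  rewrite -(bigA_distr_bigA (fun (ij : 'I_n * 'I_N) (k : 'I_c.+1) => poisson_pmf N%:R^-1 k *
     ring_weight k (y ij.2 ij.1) (y ij.2.+1 ij.1))).
  apply: ler_prod => ij _; rewrite sum_ring_weight_le andbT.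
  apply: sumr_ge0 => k _; rewrite mulr_ge0 ?poisson_pmf_ge0 // /ring_weight.
  case: eqP => _; first by rewrite ler0n.
  by rewrite /bit_weight; case: (y _ _); case/andP: p01 => ? ?; lra.
have FE : [set w | forall j, (j <= N)%N -> X (grid_time j) w = y j] = \bigcup_c F c.
  apply/seteqP; split => [w Xw|w [c _ [D _ [Xw _]]]] //.
  pose c := (\sum_(ij : 'I_n * 'I_N) rings ij.1 ij.2 w)%N.
  exists c => //; exists [ffun ij : 'I_n * 'I_N => inord (rings ij.1 ij.2 w)] => //; split => //.
  move=> i j; rewrite ffunE /= inordK // ltnS /c.
  by rewrite (bigD1 (i, j)) //= leq_addr.
rewrite FE; have mu_cvg : (P \o F) x @[x --> \oo] --> P (\bigcup_c F c).
  apply: nondecreasing_cvg_mu => //; first exact: bigcupT_measurable.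
  move=> c c' cc'; apply/subsetPset => w [D _ [Xw Dw]].
  have cc1 : (c.+1 <= c'.+1)%N by [].
  exists [ffun ij => widen_ord cc1 (D ij)] => //; split => //.
  by move=> i j; rewrite ffunE /=; exact: Dw.
rewrite -(cvg_lim _ mu_cvg) //; apply: lime_le; first by apply/cvg_ex; exists (P (\bigcup_c F c)).
by near=> c; exact: F_le.
Unshelve. all: by end_near. Qed.

Definition stationary_weight (x : cube n) : R := \prod_i bit_weight p (x i).

Definition grid_kernel : cube n -> cube n -> R := kernel p (fun=> hold_rate).

Lemma sum_stationary_weight : \sum_(x : cube n) stationary_weight x = 1.
Proof.
rewrite /stationary_weight -(bigA_distr_bigA (fun (i : 'I_n) b => bit_weight p b)).
by rewrite big1 // => i _; rewrite big_bool /bit_weight /=; ring.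
Qed.

Definition grid_path (w : T) : N.+1.-tuple (cube n) :=
  [tuple X (grid_time i) w | i < N.+1].

Lemma grid_pathE t : [set w | grid_path w = t] =
  [set w | forall j, (j <= N)%N -> X (grid_time j) w = nth [ffun=> true] t j].
Proof.
apply/seteqP; split => [w /= <- j jN|w /= wt].
  have jN' : (j < N.+1)%N by [].
  by rewrite -[j]/(val (Ordinal jN')) -tnth_nth tnth_mktuple.
apply/eq_from_tnth => i; rewrite tnth_mktuple wt -?tnth_nth //.
by rewrite -ltnS ltn_ord.
Qed.

Lemma seq_weightE (x0 : cube n) (l : seq (cube n)) : size l = N.+1 ->
  seq_weight stationary_weight grid_kernel l = path_prob (nth x0 l).
Proof.
move=> sl; rewrite /path_prob.
have -> : \prod_(ij : 'I_n * 'I_N) bit_kernel p hold_rate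
      (nth x0 l ij.2 ij.1) (nth x0 l ij.2.+1 ij.1) =
    \prod_(j < N) grid_kernel (nth x0 l j) (nth x0 l j.+1).
  rewrite /grid_kernel /kernel exchange_big /= pair_big /=.
  by apply: eq_bigr => -[].
case: l sl => [//|x l] /= [sl]; congr (_ * _).
elim: l N x sl => [|y l IH] m x /= <-; first by rewrite big_ord0.
rewrite big_ord_recl /=; congr (_ * _).
by rewrite (IH (size l)).
Qed.

(** Both sides are probability distributions on paths, so the inequality
    [probability_path_le] is an equality. *)
Lemma probability_grid_path (t : N.+1.-tuple (cube n)) :
  P [set w | grid_path w = t] = (seq_weight stationary_weight grid_kernel t)%:E.
Proof.
have mY u : measurable [set w | grid_path w = u].
  by rewrite grid_pathE; exact: measurable_path_event.
pose a u := fine (P [set w | grid_path w = u]).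
have aE u : P [set w | grid_path w = u] = (a u)%:E.
  by rewrite fineK // fin_num_measure.
pose b (u : N.+1.-tuple (cube n)) := seq_weight stationary_weight grid_kernel u.
have ab u : a u <= b u.
  rewrite -lee_fin -aE grid_pathE /b (seq_weightE [ffun=> true]) ?size_tuple //.
  exact: probability_path_le.
have suma : \sum_u a u = 1.
  apply: EFin_inj; rewrite -sumEFin; under eq_bigr do rewrite -aE.
  rewrite -(probability_finite_range P mY predT) -(probability_setT P).
  by congr (P _); apply/seteqP; split.
have sumb : \sum_u b u = 1.
  have -> : \sum_u b u = chain_mean stationary_weight grid_kernel N (fun=> 1).
    by apply: eq_bigr => u _; rewrite mulr1.
  rewrite chain_meanE; under eq_bigr => x _.
    rewrite walk_cst; last by move=> z; exact: sum_kernel.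
    rewrite mulr1; over.
  exact: sum_stationary_weight.
rewrite aE; congr EFin; apply/eqP; rewrite eq_sym -subr_eq0; apply/eqP.
have : \sum_u (b u - a u) = 0 by rewrite sumrB suma sumb subrr.
by move/psumr_eq0P => -> // u _; rewrite subr_ge0.
Qed.

Lemma probability_grid_event (B : pred (seq (cube n))) :
  measurable [set w | B (grid_path w)] /\
  P [set w | B (grid_path w)] =
    (chain_prob stationary_weight grid_kernel N B)%:E.
Proof.
have mY u : measurable [set w | grid_path w = u].
  by rewrite grid_pathE; exact: measurable_path_event.
split; first exact: (measurable_finite_range mY (fun u => B u)).
rewrite (probability_finite_range P mY (fun u => B u)) /chain_prob /chain_mean.
under eq_bigr do rewrite probability_grid_path.
rewrite sumEFin; congr EFin; rewrite big_mkcond; apply: eq_bigr => u _ /=.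
by case: (B u); rewrite ?mulr1 ?mulr0.
Qed.

End WalkLaw.
(** * The number of changes as a maximum over grids *)

Section NumChanges.
Variables (R : realType) (d : measure_display) (T : measurableType d).
Variables (P : probability T R) (n : nat) (X : R -> T -> cube n).
Variables (K : 'I_n -> R -> T -> nat) (V : 'I_n -> nat -> T -> bool).
Hypothesis K_poisson : forall i, poisson_process_rate1 P (K i).
Hypothesis X_def : forall t : R, 0 <= t -> forall w i, X t w i = V i (K i t w) w.
Variables (f : boolean_function n) (w : T).

Definition grid_value (m j : nat) : bool := f (X (grid_time R m j) w).

Definition grid_changes m : nat := changes (grid_value m) 0 m.

Lemma num_changesE :
  num_changes X f w = limn (fun m => ((grid_changes m)%:R : R)%:E).
Proof.
rewrite /num_changes; congr (limn _); apply/funext => m.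
by rewrite /grid_changes /changes big_mkord.
Qed.

Let total t : nat := (\sum_i K i t w)%N.

Lemma clock_mono i s t : 0 <= s -> s <= t -> (K i s w <= K i t w)%N.
Proof. by have [_ _ Kp _ _] := K_poisson i; exact: (Kp w).1. Qed.

(** A change needs a ring of some clock, so rings bound changes. *)
Lemma change_rings s t : 0 <= s -> s <= t ->
  (total s + (f (X s w) != f (X t w)) <= total t)%N.
Proof.
move=> s0 st; have t0 := le_trans s0 st.
case: eqP => [_|/eqP fst]; first by rewrite addn0; apply: leq_sum => i _; exact: clock_mono.
rewrite addn1 ltn_neqAle leq_sum ?andbT; last by move=> i _; exact: clock_mono.
apply: contra fst => /eqP E; apply/eqP; congr f; apply/ffunP => i.
rewrite !X_def //; congr V; apply/eqP; rewrite eqn_leq clock_mono //=.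
rewrite leqNgt; apply/negP => lt_i; move/eqP: E; apply/negP; rewrite neq_ltn.
apply/orP; left; rewrite /total (bigD1 i) //= [ltnRHS](bigD1 i) //= -addSn.
by apply: leq_add => //; apply: leq_sum => j _; exact: clock_mono.
Qed.

Lemma grid_changes_bounded m : (0 < m)%N -> (grid_changes m <= total 1)%N.
Proof.
move=> m0; have : (total (grid_time R m 0) + changes (grid_value m) 0 m <=
    total (grid_time R m m))%N.
  elim: {3 5}m => [|k IH]; first by rewrite /changes big_geq // addn0.
  rewrite (changes_cat _ (leq0n k) (leqnSn k)) {2}/changes big_nat1 addnA.
  apply: leq_trans (leq_add IH (leqnn _)) _.
  by apply: change_rings; [exact: grid_time_ge0|exact: grid_time_mono].
by rewrite [grid_time R m m]divff ?pnatr_eq0 -?lt0n //; apply: leq_trans; exact: leq_addl.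
Qed.

(** Paths are right-continuous with values in a finite set. *)
Lemma locally_constant_right t : 0 <= t ->
  exists2 eta : R, 0 < eta & forall s, t <= s -> s < t + eta -> X s w = X t w.
Proof.
move=> t0.
have near_all : \forall s \near t^'+, forall i, K i s w = K i t w.
  apply: filter_forall => i; have [_ _ Kp _ _] := K_poisson i.
  exact: (Kp w).2.
have [eta /= eta0 H] := near_all.
exists eta => // s ts seta; have [->//|st] := eqVneq s t.
have lt_ts : t < s by rewrite lt_neqAle eq_sym st.
apply/ffunP => i; rewrite !X_def ?(le_trans t0) // H //=.
by rewrite distrC ger0_norm ?subr_ge0 // ltrBlDl.
Qed.

(** By right-continuity, the value at a point of the given grid is still held at
    the next point of any fine enough grid. *)
Lemma grid_changes_refine m : (0 < m)%N ->
  exists M0, forall M, (M0 <= M)%N -> (grid_changes m <= grid_changes M)%N.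
Proof.
move=> m0.
have [eta eta0 Heta] : exists2 eta : R, 0 < eta & forall (j : 'I_m) s,
    grid_time R m j <= s -> s < grid_time R m j + eta -> X s w = X (grid_time R m j) w.
  have /choice[e He] : forall j : 'I_m, exists eta : R, 0 < eta /\ forall s,
      grid_time R m j <= s -> s < grid_time R m j + eta -> X s w = X (grid_time R m j) w.
    by move=> j; have [e e0 He] := locally_constant_right (grid_time_ge0 R m j); exists e.
  exists (\big[Num.min/1]_j e j).
    by elim/big_ind: _ => //= [x y x0 y0|j _]; [rewrite lt_min x0|have [] := He j].
  move=> j s js sj; apply: (He j).2 => //; apply: lt_le_trans sj _.
  by rewrite lerD2l bigmin_le_cond.
exists (Num.truncn eta^-1).+1 => M M0.
have Mpos : (0 < M)%N by apply: leq_trans M0.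
have Meta : M%:R^-1 < eta.
  rewrite invf_plt ?posrE ?ltr0n //; apply: lt_le_trans (truncnS_gt _) _.
  by rewrite ler_nat.
(* The first point of the finer grid that is not before [j / m]. *)
pose s j := ((M * j + m.-1) %/ m)%N.
have s_mono j : (s j <= s j.+1)%N by apply: leq_div2r; rewrite leq_add2r leq_mul2l leqnSn orbT.
have s0E : s 0%N = 0%N by rewrite /s muln0 add0n divn_small // prednK.
have smE : s m = M by rewrite /s divnMDl // divn_small ?addn0 // prednK.
have s_lo j : (M * j <= s j * m)%N.
  have := divn_eq (M * j + m.-1) m; have := ltn_pmod (M * j + m.-1) m0.
  by rewrite -/(s j); lia.
have s_hi j : (s j * m < M * j + m)%N.
  by apply: leq_ltn_trans (leq_trunc_div _ _) _; rewrite ltn_add2l prednK.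
have sE j : (j <= m)%N -> grid_value M (s j) = grid_value m j.
  rewrite leq_eqVlt => /orP[/eqP ->|jm].
    by rewrite smE /grid_value /grid_time !divff ?pnatr_eq0 -?lt0n.
  congr f; have mR : 0 < m%:R :> R by rewrite ltr0n.
  have MR : 0 < M%:R :> R by rewrite ltr0n.
  apply: (Heta (Ordinal jm)) => /=; rewrite /grid_time.
    by rewrite ler_pdivrMr // mulrAC ler_pdivlMr // -!natrM ler_nat mulnC.
  apply: le_lt_trans (_ : _ <= j%:R / m%:R + M%:R^-1) _; last by rewrite ltrD2l.
  have -> : j%:R / m%:R + M%:R^-1 = (j%:R * M%:R + m%:R) / m%:R / M%:R :> R.
    by field; rewrite !gt_eqF.
  rewrite ler_pM2r ?invr_gt0 // ler_pdivlMr // -!natrM -natrD ler_nat.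
  by rewrite [(j * M)%N]mulnC ltnW.
rewrite /grid_changes /changes big_mkord.
have -> : (\sum_(i < m) (grid_value m i != grid_value m i.+1) =
    \sum_(i < m) (grid_value M (s i) != grid_value M (s i.+1)))%N.
  by apply: eq_bigr => i _; rewrite !sE // ltnW.
by have := sub_grid_changes (grid_value M) m s_mono; rewrite s0E smE.
Qed.

(** Along a fixed path the number of observed changes is bounded, and refining
    the grid eventually recovers the changes seen on any given grid; hence it is
    eventually equal to its maximum. *)
Lemma num_changes_max : exists C : nat,
  [/\ num_changes X f w = (C%:R)%:E,
      forall m, (0 < m)%N -> (grid_changes m <= C)%N &
      exists2 m, (0 < m)%N & grid_changes m = C].
Proof.
pose attained C := `[< exists2 m, (0 < m)%N & grid_changes m = C >].
have ex_att : exists C, attained C by exists (grid_changes 1); apply/asboolP; exists 1%N.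
have ub_att C : attained C -> (C <= total 1)%N.
  by move/asboolP => [m m0 <-]; exact: grid_changes_bounded.
have [C /asboolP[m m0 mC] Cmax] := ex_maxnP ex_att ub_att.
have C_ub m' : (0 < m')%N -> (grid_changes m' <= C)%N.
  by move=> m'0; apply: Cmax; apply/asboolP; exists m'.
exists C; split => //; last by exists m.
have [M0 HM] := grid_changes_refine m0.
rewrite num_changesE; apply/cvg_lim => //; apply: cvg_near_cst.
exists (maxn 1 M0) => // M; rewrite /= geq_max => /andP[M1 M0M].
by congr ((_%:R)%:E); apply/eqP; rewrite eqn_leq C_ub //= -mC HM.
Qed.
End NumChanges.
(** * Boolean functions of the walk *)

Lemma limf_einf_gt0_near (R : realType) (u : nat -> \bar R)
    (F : set_system nat) : (0 < limf_einf u F)%E ->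
  exists2 c : R, 0 < c & exists2 V, F V & forall x, V x -> (c%:E <= u x)%E.
Proof.
rewrite limf_einfE => /ereal_sup_gt[_ [V FV <-]] inf_gt0.
have V_ge x : V x -> (ereal_inf (u @` V) <= u x)%E.
  by move=> Vx; apply: ereal_inf_lbound; exists x.
case: (ereal_inf _) inf_gt0 V_ge => [r|_|] // => [r0|] V_ge.
  by exists r; [rewrite lte_fin in r0|exists V].
exists 1 => //; exists V => // x /V_ge; apply: le_trans.
exact: leey.
Qed.

Lemma limf_esup_lt1_near (R : realType) (u : nat -> \bar R)
    (F : set_system nat) : (limf_esup u F < 1)%E ->
  exists2 c : R, 0 < c & exists2 V, F V & forall x, V x -> (u x <= (1 - c)%:E)%E.
Proof.
rewrite limf_esupE => /ereal_inf_lt[_ [V FV <-]] sup_lt1.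
have V_le x : V x -> (u x <= ereal_sup (u @` V))%E.
  by move=> Vx; apply: ereal_sup_ubound; exists x.
case: (ereal_sup _) sup_lt1 V_le => [r||_] // => [r1|] V_le.
  exists (1 - r); first by rewrite subr_gt0 -lte_fin.
  by exists V => // x /V_le; rewrite subKr.
exists 1 => //; exists V => // x /V_le/le_trans; apply.
exact: leNye.
Qed.

Lemma iter_noise (R : realFieldType) n (p rho : R) k (g : cube n -> R) x :
  iter k (transition (kernel p (fun=> rho))) g x = noise p (fun=> rho ^+ k) g x.
Proof.
elim: k x => [|k IH] x; first by rewrite -[LHS](noise_id p).
rewrite iterS /transition; under eq_bigr do rewrite IH.
by rewrite -/(noise p _ _ x) noise_comp; apply: eq_noise => // j; rewrite exprS.
Qed.

Section BooleanFunctions.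
Variables (R : realFieldType) (n : nat) (p lam : R).
Hypothesis lam_gt0 : 0 < lam.
Hypothesis p_lam : lam <= p <= 1 - lam.
Variable f : boolean_function n.

Definition real_of_bool (x : cube n) : R := (f x)%:R.

Lemma real_of_bool01 x : 0 <= real_of_bool x <= 1.
Proof. by rewrite /real_of_bool ler0n lern1 leq_b1. Qed.

Lemma real_of_bool_sqr x : real_of_bool x ^+ 2 = real_of_bool x.
Proof. by rewrite /real_of_bool; case: (f x); rewrite ?expr1n ?expr0n. Qed.

(** Half the probability of different values at correlation [tau ^+ 2] is the
    energy lost by noise of rate [tau], to which the spectral gap applies. *)
Lemma expect_diff_ge tau : 0 <= tau <= 1 ->
  2 * ((1 - tau) * lam ^+ 2 *
    (expect p real_of_bool - expect p real_of_bool ^+ 2)) <=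
  expect p (fun x => noise p (fun=> tau ^+ 2) (fun y => (f x != f y)%:R) x).
Proof.
move=> t01; have gap := spectral_gap lam_gt0 p_lam real_of_bool t01.
have e2 : expect p (fun x => real_of_bool x ^+ 2) = expect p real_of_bool.
  by apply: eq_expect => x; exact: real_of_bool_sqr.
rewrite e2 in gap.
have diffE x : noise p (fun=> tau ^+ 2) (fun y => (f x != f y)%:R) x =
    real_of_bool x + noise p (fun=> tau ^+ 2) real_of_bool x
    - 2 * (real_of_bool x * noise p (fun=> tau ^+ 2) real_of_bool x).
  rewrite -{1}(noise_cst p (fun=> tau ^+ 2) (real_of_bool x) x) -noiseD mulrA -noiseZ -noiseB.
  apply: eq_noise => // y; rewrite /real_of_bool.
  by case: (f x); case: (f y) => /=; ring.
rewrite (eq_expect p diffE) expectB expectD expectZ expect_noise.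
suff -> : expect p (fun x => real_of_bool x * noise p (fun=> tau ^+ 2) real_of_bool x) =
    expect p (fun x => noise p (fun=> tau) real_of_bool x ^+ 2) by lra.
under [RHS]eq_expect do rewrite expr2.
rewrite -expect_noise_sym; apply: eq_expect => x; congr (_ * _).
by rewrite noise_comp; apply: eq_noise => // j; rewrite expr2.
Qed.

(** Resampling bit [i] to [b] changes the value when the bit is pivotal and has
    the other value, and these two events are independent. *)
Lemma expect_resample i b :
  expect p (fun x => (f x != f (set_bit i b x))%:R) =
  bit_weight p (~~ b) * expect p (fun x => `|discrete_derivative i real_of_bool x|).
Proof.
rewrite -(expect_noise p (on [:: i] 0)) -expectZ; apply: eq_expect => x.
rewrite noise_one !bit_kernel0 !set_bit_set /discrete_derivative /real_of_bool.
by case: b => /=; case: (f (set_bit i true x)); case: (f (set_bit i false x)) => /=;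
  rewrite ?subrr ?subr0 ?sub0r ?normrN ?normr1 ?normr0; ring.
Qed.

End BooleanFunctions.
Section WalkAndFunction.
Variables (R : realType) (d : measure_display) (T : measurableType d).
Variables (P : probability T R) (p lam : R) (n : nat) (X : R -> T -> cube n).
Hypothesis lam_gt0 : 0 < lam.
Hypothesis p_lam : lam <= p <= 1 - lam.
Hypothesis walk : biased_random_walk P p X.
Variable f : boolean_function n.

Local Notation x0 := ([ffun=> true] : cube n).
Local Notation E := (expect p).
Local Notation fR := (real_of_bool R f).
Local Notation gc := (grid_changes X f).

Lemma grid_event_law N (B : pred (seq (cube n))) : (0 < N)%N ->
  measurable [set w | B (grid_path X N w)] /\
  P [set w | B (grid_path X N w)] =
    (chain_prob (stationary_weight p (n := n)) (grid_kernel p N) N B)%:E.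
Proof.
move=> N0; have [K [V [hK hV hKV hX]]] := walk.
have p01 : 0 < p < 1.
  by case/andP: p_lam => p1 p2; have l0 := lam_gt0; apply/andP; split; lra.
exact: (probability_grid_event p01 hK hV hKV hX N0 B).
Qed.

Lemma nth_grid_path N w j : (j <= N)%N ->
  nth x0 (grid_path X N w) j = X (grid_time R N j) w.
Proof.
move=> jN; have jN' : (j < N.+1)%N by [].
by rewrite -[j]/(val (Ordinal jN')) -tnth_nth tnth_mktuple.
Qed.

Lemma trace_grid_path N w j : (j <= N)%N ->
  trace x0 f (grid_path X N w) j = grid_value X f w N j.
Proof. by move=> jN; rewrite /trace nth_grid_path. Qed.

Lemma changes_grid_path N w : changes (trace x0 f (grid_path X N w)) 0 N = gc w N.
Proof. by apply: eq_changes => j jN; exact: trace_grid_path. Qed.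

Lemma coarse_changes_grid_path A C w : (0 < C)%N ->
  coarse_changes A C (trace x0 f (grid_path X (A * C) w)) = gc w A.
Proof.
move=> C0; rewrite /coarse_changes /grid_changes /changes big_mkord.
have e i : (i <= A)%N -> trace x0 f (grid_path X (A * C) w) (i * C) = grid_value X f w A i.
  move=> iA; rewrite trace_grid_path ?leq_mul2r ?iA ?orbT //.
  congr (f (X _ _)); rewrite /grid_time !natrM.
  by rewrite invfM mulrACA divff ?mulr1 // pnatr_eq0 -lt0n.
by apply: eq_bigr => i _; rewrite !e // ltnW.
Qed.

Lemma stationary_weight_ge0 (x : cube n) : 0 <= stationary_weight p x.
Proof.
apply: prodr_ge0 => i _.
by apply: le_trans (bit_weight_ge p_lam _); exact: ltW.
Qed.

Lemma grid_kernel_ge0 N (x y : cube n) : 0 <= grid_kernel p N x y.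
Proof. by apply: (kernel_ge0 lam_gt0 p_lam) => i; exact: hold_rate01. Qed.

Lemma grid_kernel_sum N (x : cube n) : \sum_y grid_kernel p N x y = 1.
Proof. exact: sum_kernel. Qed.

Lemma grid_kernel_rev N (x y : cube n) :
  stationary_weight p x * grid_kernel p N x y = stationary_weight p y * grid_kernel p N y x.
Proof. exact: kernel_reversible. Qed.

Lemma initial_law (B : pred (cube n)) :
  measurable [set w | B (X 0 w)] /\
  P [set w | B (X 0 w)] = (E (fun x => (B x)%:R))%:E.
Proof.
have [] := grid_event_law (fun l => B (nth x0 l 0)) (ltn0Sn 0).
have -> : [set w | B (nth x0 (grid_path X 1 w) 0)] = [set w | B (X 0 w)].
  apply/funext => w /=; rewrite nth_grid_path //.
  by rewrite /grid_time mul0r.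
move=> mB ->; split => //; congr EFin.
have := chain_marginal x0 (grid_kernel_sum 1) (@grid_kernel_rev 1) 0 (fun x => (B x)%:R).
rewrite -/(E _) => <-.
rewrite /chain_prob -(chain_take _ (grid_kernel_sum 1) _ (leq0n 1)).
by apply: eq_chain => l _; rewrite nth_take.
Qed.

(** The factor 2 arises because drawing 1 at a bit equal to 0 and drawing 0 at a
    bit equal to 1 are equally likely. *)
Lemma influenceE i : influence P p X f i =
  (2 * (p * (1 - p)) * E (fun x => `|discrete_derivative i fR x|))%:E.
Proof.
have p01 : 0 <= p <= 1.
  by case/andP: p_lam => p1 p2; have l0 := lam_gt0; apply/andP; split; lra.
pose A b := [set w | f (X 0 w) != f (set_bit i b (X 0 w))].
have [mA PA] : (forall b, measurable (A b)) /\ (forall b, P (A b) =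
    (E (fun x => (f x != f (set_bit i b x))%:R))%:E).
  split=> b; first exact: (initial_law (fun x => f x != f (set_bit i b x))).1.
  exact: (initial_law (fun x => f x != f (set_bit i b x))).2.
rewrite /influence.
have -> : [set z : T * bool | f (X 0 z.1) <> f (set_bit i z.2 (X 0 z.1))] =
    (A true `*` [set true]) `|` (A false `*` [set false]).
  apply/seteqP; split => [[w b] /= /eqP H|[w b] /= [] [H ->]]; [|exact/eqP..].
  by case: b H => H; [left|right].
have mR b : measurable (A b `*` [set b]) by exact: measurableX.
have prodE b : (P \x bernoulli_prob p)%E (A b `*` [set b]) =
    (P (A b) * bernoulli_prob p [set b])%E by exact: product_measure1E.
rewrite measureU //; last by rewrite -subset0 => -[w b] [] [_ /= ->] [_ /=].
transitivity (P (A true) * bernoulli_prob p [set true] +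
    P (A false) * bernoulli_prob p [set false])%E.
  by rewrite -!prodE.
rewrite !PA !expect_resample.
have wt b : bernoulli_prob p [set b] = (bit_weight p b)%:E.
  by rewrite /bernoulli_prob p01 fsbig_set1.
by rewrite !wt -!EFinM -EFinD /=; congr EFin; ring.
Qed.

Hypothesis f_regular : regular_bf P p X f.
Hypothesis f_incr : increasing_bf f.

Lemma increasing_derivative_ge0 i x : 0 <= discrete_derivative i fR x.
Proof.
rewrite /discrete_derivative /real_of_bool subr_ge0 ler_nat; apply: f_incr => j.
by rewrite !ffunE; case: eqP.
Qed.

(** For an increasing function the influence of a bit is proportional to its mean
    derivative.  All bits having the same influence, Bessel's inequality makes it
    at most of the order of the inverse square root of their number. *)
Lemma regular_small_derivative eta : 0 < eta -> 1 <= lam ^+ 2 * n%:R * eta ^+ 2 ->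
  forall i, E (fun x => `|discrete_derivative i fR x|) <= eta.
Proof.
move=> eta0 n_large i; set J := E _.
have pp : p * (1 - p) != 0.
  case/andP: p_lam => p1 p2; have l0 := lam_gt0.
  by rewrite mulf_neq0 // gt_eqF //; lra.
have same j : E (discrete_derivative j fR) = J.
  have -> : E (discrete_derivative j fR) = E (fun x => `|discrete_derivative j fR x|).
    by apply: eq_expect => x; rewrite ger0_norm // increasing_derivative_ge0.
  have := f_regular i j; rewrite !influenceE => -[H].
  by apply/esym; apply: (mulfI _ H); rewrite mulf_neq0 // pnatr_eq0.
have J0 : 0 <= J by apply: (expect_ge0 lam_gt0 p_lam) => x.
have := sum_mean_derivative_sqr lam_gt0 p_lam (real_of_bool01 R f).
under eq_bigr do rewrite same.
rewrite sumr_const card_ord -mulr_natl mulrA => /le_trans/(_ n_large).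
have c0 : 0 < lam ^+ 2 * n%:R.
  rewrite lt_neqAle mulr_ge0 ?sqr_ge0 ?ler0n // andbT eq_sym.
  by apply: contraTneq n_large => ->; rewrite mul0r -ltNge ltr01.
by rewrite ler_pM2l // ler_sqr ?nnegrE // ltW.
Qed.

End WalkAndFunction.
(** * Comparing two grids *)

Section LevelInequality.
Variables (R : realType) (d : measure_display) (T : measurableType d).
Variables (P : probability T R) (p lam : R) (n : nat) (X : R -> T -> cube n).
Hypothesis lam_gt0 : 0 < lam.
Hypothesis p_lam : lam <= p <= 1 - lam.
Hypothesis walk : biased_random_walk P p X.
Variable f : boolean_function n.

Local Notation x0 := ([ffun=> true] : cube n).
Local Notation E := (expect p).
Local Notation fR := (real_of_bool R f).
Local Notation gc := (grid_changes X f).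

Lemma hold_rate_exp N k : (0 < N)%N ->
  hold_rate R N ^+ k = expR (- (k%:R / N%:R)).
Proof. by move=> N0; rewrite /hold_rate -expRM_natl mulrN. Qed.

(** The jump estimate [change_le_jumps] for the lag [b], a quarter of the coarse
    step, combined with the fourth-moment bound for one step of the forecast and
    the lower bound [expect_diff_ge] on the probability of a change.  The
    forecast at this lag is noise of rate [sigma] applied twice. *)
Lemma variance_le_refinement A b : (0 < A)%N -> (1 < b)%N ->
  let N := (A * b.*2.*2)%N in
  let sigma : R := expR (- (8 * A%:R)^-1) in
  let K := ((1 - sigma) * lam ^+ 2)^-1 in
  exists r : R,
    P [set w | (gc w A < gc w N)%N] = r%:E /\
    2 * ((1 - expR (- 8^-1)) * lam ^+ 2 * (E fR - E fR ^+ 2)) <=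
    12 * r + 729 * (K ^+ 2 / N%:R) + 162 *
      \sum_i E (fun x => discrete_derivative i
        (noise p (fun=> sigma) (noise p (fun=> sigma) fR)) x ^+ 4).
Proof.
move=> A0 b1 N sigma K.
have b0 : (0 < b)%N by apply: ltn_trans b1.
have N0 : (0 < N)%N by rewrite muln_gt0 A0 !double_gt0.
have NR : 0 < N%:R :> R by rewrite ltr0n.
have AR : 0 < A%:R :> R by rewrite ltr0n.
have NE : N%:R = 4 * A%:R * b%:R :> R.
  by rewrite /N -!muln2 !natrM; ring.
set rho := hold_rate R N.
have rho01 : 0 <= rho <= 1 by exact: hold_rate01.
have [_ PR] := grid_event_law lam_gt0 p_lam walk
  (fun l => refines A b.*2.*2 (trace x0 f l)) N0.
exists (chain_prob (stationary_weight p (n := n)) (grid_kernel p N) N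
  (fun l => refines A b.*2.*2 (trace x0 f l))); split.
  rewrite -PR; congr (P _); apply/funext => w /=.
  by rewrite /refines changes_grid_path coarse_changes_grid_path // !double_gt0.
have b2 : (b.+1 < b.*2)%N by rewrite -addnn -addn1 ltn_add2l.
have := change_le_jumps x0 (stationary_weight_ge0 (n := n) lam_gt0 p_lam)
  (grid_kernel_ge0 lam_gt0 p_lam N) (grid_kernel_sum p N) (grid_kernel_rev p N)
  f A0 b2.
rewrite -/N; set r := chain_prob _ _ _ _.
pose u := noise p (fun=> sigma) (noise p (fun=> sigma) fR).
have s01 : 0 <= sigma <= 1.
  by rewrite expR_ge0 -expR0 ler_expR oppr_le0 invr_ge0 mulr_ge0 ?ler0n.
have forecastE x : forecast (grid_kernel p N) f b x = u x.
  rewrite /forecast /grid_kernel iter_noise /u noise_comp.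
  apply: eq_noise => // j; rewrite -/rho hold_rate_exp // /sigma -expRD.
  congr expR; rewrite NE; field.
  by rewrite !gt_eqF ?ltr0n.
have forecastS x : forecast (grid_kernel p N) f b.+1 x = noise p (fun=> rho) u x.
  by rewrite /forecast iterS; apply: eq_bigr => y _; rewrite -forecastE.
have -> : \sum_x stationary_weight p x * transition (grid_kernel p N)
    (fun y => (forecast (grid_kernel p N) f b y -
               forecast (grid_kernel p N) f b.+1 x) ^+ 4) x =
    E (fun x => noise p (fun=> rho) (fun y => (u y - noise p (fun=> rho) u x) ^+ 4) x).
  apply: eq_bigr => x _; congr (_ * _); apply: eq_bigr => y _.
  by rewrite forecastE forecastS.
(* The two times compared are [k] steps apart, at least a quarter of the unit
   interval. *)
set k := (N - b.*2.+1)%N.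
pose tau := expR (- (k%:R / (2 * N%:R))) : R.
have t01 : 0 <= tau <= 1.
  by rewrite expR_ge0 -expR0 ler_expR oppr_le0 divr_ge0 ?mulr_ge0 ?ler0n.
have -> : \sum_x stationary_weight p x *
    iter k (transition (grid_kernel p N)) (fun y => (f x != f y)%:R) x =
    E (fun x => noise p (fun=> tau ^+ 2) (fun y => (f x != f y)%:R) x).
  apply: eq_bigr => x _; congr (_ * _); rewrite iter_noise.
  apply: eq_noise => // j; rewrite -/rho hold_rate_exp // /tau -expRM_natl.
  congr expR; field.
  by rewrite gt_eqF.
have lower := expect_diff_ge lam_gt0 p_lam f t01.
have tau_le : tau <= expR (- 8^-1).
  rewrite ler_expR lerN2 ler_pdivlMr ?mulr_gt0 //.
  have -> : 8^-1 * (2 * N%:R) = N%:R / 4 :> R by field.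
  rewrite ler_pdivrMr // -natrM ler_nat /k /N -!muln2; nia.
have var0 : 0 <= E fR - E fR ^+ 2.
  rewrite subr_ge0; have e1 : 0 <= E fR <= 1.
    rewrite (expect_ge0 lam_gt0 p_lam) /=; last by move=> x; case/andP: (real_of_bool01 R f x).
    rewrite -[leRHS](expect_cst n p); apply: (le_expect lam_gt0 p_lam) => x.
    by case/andP: (real_of_bool01 R f x).
  by case/andP: e1 => h0 h1; rewrite expr2 ler_piMr.
have l2 : 0 <= lam ^+ 2 by exact: sqr_ge0.
have lower' : 2 * ((1 - expR (- 8^-1)) * lam ^+ 2 * (E fR - E fR ^+ 2)) <=
    2 * ((1 - tau) * lam ^+ 2 * (E fR - E fR ^+ 2)).
  by rewrite ler_wpM2l // ler_wpM2r // ler_wpM2r // lerD2l lerN2.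
move=> upper; apply: le_trans lower' _; apply: le_trans lower _.
apply: le_trans upper _; rewrite -addrA lerD2l.
have c0 : 0 < (1 - sigma) * lam ^+ 2.
  rewrite mulr_gt0 ?exprn_gt0 // subr_gt0 -expR0 ltr_expR oppr_lt0 invr_gt0 mulr_gt0 //.
have K0 : 0 <= K by rewrite invr_ge0 ltW.
have grad y : \sum_i discrete_derivative i u y ^+ 2 <= K.
  rewrite /K -[leRHS]mul1r ler_pdivlMr // mulrC; apply: (gradient_bound lam_gt0 p_lam) => // z.
  exact: (noise_unit_norm lam_gt0 p_lam z s01 (real_of_bool01 R f)).
have := expect_fourth_moment_noise lam_gt0 p_lam rho01 grad.
set S := \sum_i _; set M4 := E _ => hM.
have rho_lo : 1 - rho <= N%:R^-1.
  by rewrite lerBlDr -lerBlDl; exact: expR_ge1Dx.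
have r0 : 0 <= 1 - rho by rewrite subr_ge0; case/andP: rho01.
have S0 : 0 <= S.
  apply: sumr_ge0 => i _; apply: (expect_ge0 lam_gt0 p_lam) => x.
  by rewrite (exprM _ 2 2) sqr_ge0.
have h1 : N%:R * ((1 - rho) * K) ^+ 2 <= K ^+ 2 / N%:R.
  rewrite exprMn mulrA mulrC ler_wpM2l ?sqr_ge0 //.
  rewrite expr2 mulrA -[leRHS]mul1r; apply: ler_pM => //; first by rewrite mulr_ge0 ?ler0n.
  by rewrite mulrC -ler_pdivlMr // mul1r.
have h2 : N%:R * ((1 - rho) * S) <= S.
  by rewrite mulrA ler_piMl // mulrC -ler_pdivlMr // mul1r.
have := ler_wpM2l (ltW NR) hM; move: h1 h2.
set a1 := ((1 - rho) * K) ^+ 2; lra.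
Qed.

End LevelInequality.
Lemma coarse_changes_refine A B C g :
  (coarse_changes A (B * C) g <= coarse_changes (A * B) C g)%N.
Proof.
have -> : coarse_changes (A * B) C g = changes (fun j => g (j * C)%N) 0 (A * B).
  by rewrite /changes big_mkord.
have smono i : (i * B <= i.+1 * B)%N by rewrite leq_mul2r leqnSn orbT.
have := sub_grid_changes (fun j => g (j * C)%N) A smono.
rewrite mul0n; apply: leq_trans.
by apply: leq_sum => i _; rewrite !mulnA.
Qed.

Section Pigeonhole.
Variables (R : realType) (d : measure_display) (T : measurableType d).
Variables (P : probability T R) (p lam : R) (n : nat) (X : R -> T -> cube n).
Hypothesis lam_gt0 : 0 < lam.
Hypothesis p_lam : lam <= p <= 1 - lam.
Hypothesis walk : biased_random_walk P p X.
Variable f : boolean_function n.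

Local Notation x0 := ([ffun=> true] : cube n).
Local Notation gc := (grid_changes X f).
Local Notation pi := (stationary_weight p (n := n)).

Lemma measurable_grid_changes m (B : pred nat) : (0 < m)%N ->
  measurable [set w | B (gc w m)].
Proof.
move=> m0; have [mB _] := grid_event_law lam_gt0 p_lam walk
  (fun l => B (changes (trace x0 f l) 0 m)) m0.
suff <- : [set w | B (changes (trace x0 f (grid_path X m w)) 0 m)] = [set w | B (gc w m)].
  exact: mB.
by apply/funext => w; rewrite /= changes_grid_path.
Qed.

(** The number of changes is the largest of the grid counts, which also shows
    that it is measurable. *)
Lemma grid_changes_le_num_changes k m : (0 < m)%N ->
  (P [set w | (k <= gc w m)%N] <= P [set w | (k%:R)%:E <= num_changes X f w])%E.
Proof.
move=> m0; have [K [V [hK _ _ hX]]] := walk.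
have -> : [set w | (k%:R)%:E <= num_changes X f w]%E =
    \bigcup_m' [set w | (k <= gc w m'.+1)%N].
  apply/seteqP; split => w /=; have [C [-> C_ub [m1 m10 m1C]]] := num_changes_max hK hX f w.
    rewrite lee_fin ler_nat => kC; exists m1.-1 => //=.
    by rewrite prednK // m1C.
  move=> [m' _ /= km]; rewrite lee_fin ler_nat; apply: leq_trans km _.
  exact: C_ub.
apply: le_measure.
- by apply: mem_set; exact: (measurable_grid_changes (fun v => (k <= v)%N) m0).
- apply: mem_set; apply: bigcupT_measurable => m'.
  exact: (measurable_grid_changes (fun v => (k <= v)%N) (ltn0Sn m')).
- by move=> w /= kw; exists m.-1 => //=; rewrite prednK.
Qed.

(** Every refinement that reveals a new change raises the count, so a path with
    fewer than [k] changes on the finest grid has fewer than [k] such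
    refinements; averaging over the [L] refinements gives the bound. *)
Lemma exists_quiet_refinement (M : nat -> nat) k L (eps : R) :
  (forall l, (0 < M l)%N) -> (forall l, (M l %| M l.+1)%N) -> (0 < L)%N ->
  (P [set w | (k <= gc w (M L))%N] <= eps%:E)%E ->
  exists2 l, (l < L)%N &
    (P [set w | (gc w (M l) < gc w (M l.+1))%N] <= (k%:R / L%:R + eps)%:E)%E.
Proof.
move=> M0 Mdvd L0 tight.
have Mdvd' l j : (M l %| M (l + j))%N.
  elim: j => [|j IH]; first by rewrite addn0 dvdnn.
  by rewrite addnS; apply: dvdn_trans IH (Mdvd _).
have dvdL l : (l <= L)%N -> (M l %| M L)%N by move=> /subnKC <-.
pose cc l (s : seq (cube n)) := coarse_changes (M l) (M L %/ M l) (trace x0 f s).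
have ccE l w : (l <= L)%N -> cc l (grid_path X (M L) w) = gc w (M l).
  move=> lL; have q0 : (0 < M L %/ M l)%N by rewrite divn_gt0 // dvdn_leq // dvdL.
  have := coarse_changes_grid_path X f (M l) w q0.
  by rewrite [(M l * _)%N]mulnC divnK // dvdL.
have cc_mono l s : (l < L)%N -> (cc l s <= cc l.+1 s)%N.
  move=> lL; rewrite /cc; have /dvdnP[q qE] := Mdvd l.
  have q0 : (0 < q)%N by have := M0 l.+1; rewrite qE muln_gt0 => /andP[].
  have -> : (M L %/ M l = q * (M L %/ M l.+1))%N.
    have /dvdnP[t ->] := dvdL _ lL.
    by rewrite mulnK // qE mulnA mulnK // mulnC.
  by rewrite {2}qE [(q * M l)%N]mulnC; exact: coarse_changes_refine.
pose r l := chain_prob pi (grid_kernel p (M L)) (M L) (fun s => (cc l s < cc l.+1 s)%N).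
have rE l : (l < L)%N -> P [set w | (gc w (M l) < gc w (M l.+1))%N] = (r l)%:E.
  move=> lL; have [_ <-] := grid_event_law lam_gt0 p_lam walk
    (fun s => (cc l s < cc l.+1 s)%N) (M0 L).
  by congr (P _); apply/funext => w; rewrite /= !ccE // ltnW.
pose e := chain_prob pi (grid_kernel p (M L)) (M L) (fun s => (k <= cc L s)%N).
have e_le : e <= eps.
  rewrite -lee_fin; have [_ <-] := grid_event_law lam_gt0 p_lam walk
    (fun s => (k <= cc L s)%N) (M0 L).
  apply: le_trans tight; rewrite le_eqVlt; apply/orP; left; apply/eqP.
  by congr (P _); apply/funext => w; rewrite /= ccE.
have sum_r : \sum_(l < L) r l <= k%:R + L%:R * e.
  rewrite /r /chain_prob -chain_sum.
  have one : chain_mean pi (grid_kernel p (M L)) (M L) (fun=> 1) = 1.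
    have := (grid_event_law lam_gt0 p_lam walk (fun=> true) (M0 L)).2.
    have -> : [set w | (fun _ : seq (cube n) => true) (grid_path X (M L) w)] = setT.
      by apply/seteqP; split.
    by rewrite probability_setT => -[].
  have -> : k%:R + L%:R * e = chain_mean pi (grid_kernel p (M L)) (M L)
      (fun s => k%:R * 1 + L%:R * (k <= cc L s)%N%:R).
    by rewrite chainD !chainZ one mulr1.
  apply: chain_le => [x|x y|s _]; [exact: stationary_weight_ge0 lam_gt0 p_lam x|
    exact: grid_kernel_ge0 lam_gt0 p_lam _ x y|].
  rewrite /= mulr1 -natr_sum -natrM -natrD ler_nat.
  have sum_cc m : (m <= L)%N -> (\sum_(l < m) (cc l s < cc l.+1 s) <= cc m s)%N.
    elim: m => [|m IH] mL; first by rewrite big_ord0.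
    rewrite big_ord_recr /=; have := cc_mono m s mL; have := IH (ltnW mL).
    by case: ltnP => /=; lia.
  have [kL|Lk] := leqP k (cc L s).
    rewrite muln1; apply: leq_trans (leq_addl _ _).
    rewrite -[X in (_ <= X)%N](card_ord L) -sum1_card; apply: leq_sum => l _.
    exact: leq_b1.
  by rewrite muln0 addn0; apply: leq_trans (sum_cc L (leqnn L)) (ltnW Lk).
have LR : 0 < L%:R :> R by rewrite ltr0n.
have [[l lsmall]|all_big] := pselect (exists l : 'I_L, r l <= k%:R / L%:R + eps).
  by exists l => //; rewrite (rE l (ltn_ord l)) lee_fin.
have : \sum_(l < L) (k%:R / L%:R + eps) < \sum_(l < L) r l.
  apply: ltr_sum => [|l _]; first by apply/hasP; exists (Ordinal L0); rewrite ?mem_index_enum.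
  by rewrite ltNge; apply/negP => h; apply: all_big; exists l.
have -> : \sum_(l < L) (k%:R / L%:R + eps) = k%:R + L%:R * eps.
  by rewrite sumr_const card_ord -[LHS]mulr_natl mulrDr mulrCA divff ?gt_eqF // mulr1.
have := ler_wpM2l (ltW LR) e_le; lra.
Qed.

End Pigeonhole.
(** * Regular increasing functions are not tame *)

Unset Implicit Arguments.

Theorem theorem1p4 (R : realType) (p : nat -> R)
    (d : nat -> measure_display) (T : forall n, measurableType (d n))
    (P : forall n, probability (T n) R)
    (X : forall n, R -> T n -> {ffun 'I_n -> bool})
    (NN : set nat) (f : forall n, {ffun 'I_n -> bool} -> bool)
    (p01 : forall n, (1 <= n)%N -> 0 < p n < 1)
    (p_inf : (0 < limn_einf (fun n => (p n)%:E))%E)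
    (p_inf_sup : (limn_einf (fun n => (p n)%:E)
                  <= limn_esup (fun n => (p n)%:E))%E)
    (p_sup : (limn_esup (fun n => (p n)%:E) < 1)%E)
    (X_walk : forall n, (1 <= n)%N -> biased_random_walk (P n) (p n) (X n))
    (NN_inf : infinite_set NN)
    (NN_ge1 : NN `<=` [set n | (1 <= n)%N])
    (f_nondeg : non_degenerate P X NN f)
    (f_regular : forall n, NN n -> regular_bf (P n) (p n) (X n) (f n))
    (f_incr : forall n, NN n -> increasing_bf (f n)) :
  ~ tame P X NN f.
Proof.
move=> f_tame.
have le_of_sum (a1 a2 a3 a4 a5 a6 n : nat) : (a1 + a2 + a3 + a4 + a5 + a6 <= n)%N ->
    [/\ a1 <= n, a2 <= n & a3 <= n]%N /\ [/\ a4 <= n, a5 <= n & a6 <= n]%N.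
  by move=> h; split; split; lia.
have [c1 c10 [V1 [m1 _ V1m] pV1]] := limf_einf_gt0_near p_inf.
have [c2 c20 [V2 [m2 _ V2m] pV2]] := limf_esup_lt1_near p_sup.
have [f_inf _ f_sup] := f_nondeg.
have [v1 v10 [V3 [m3 _ V3m] qV3]] := limf_einf_gt0_near f_inf.
have [v2 v20 [V4 [m4 _ V4m] qV4]] := limf_esup_lt1_near f_sup.
pose lam := Num.min c1 c2; pose v := Num.min v1 v2.
have lam0 : 0 < lam by rewrite lt_min c10.
have v0 : 0 < v by rewrite lt_min v10.
(* The lower bound that [variance_le_refinement] would contradict: its three
   upper terms are made at most 24/100, 1/4 and 1/4 of [c0]. *)
pose c0 := 2 * ((1 - expR (- 8^-1)) * lam ^+ 2 * v ^+ 2).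
have c00 : 0 < c0.
  rewrite !mulr_gt0 ?exprn_gt0 // subr_gt0 -expR0 ltr_expR oppr_lt0 invr_gt0 //.
pose eps := c0 / 100.
have eps0 : 0 < eps by rewrite divr_gt0.
have [k [n1 [_ _ f_tight]]] := f_tame eps eps0.
pose L := (Num.truncn (k%:R / eps)).+1.
have kL : k%:R / L%:R <= eps.
  rewrite ler_pdivrMr ?ltr0n // -ler_pdivrMl // mulrC.
  exact/ltW/truncnS_gt.
pose sigma A : R := expR (- (8 * A%:R)^-1).
pose K A := ((1 - sigma A) * lam ^+ 2)^-1.
pose b A := (Num.truncn (729 * K A ^+ 2 / (c0 / 4))).+2.
(* Each grid is refined enough for the gradient of the forecast at the lag that
   it determines. *)
pose M := fix M l := if l is l'.+1 then (M l' * (b (M l')).*2.*2)%N else 1%N.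
have M0 l : (0 < M l)%N by elim: l => //= l IH; rewrite muln_gt0 IH.
have Mdvd l : (M l %| M l.+1)%N by rewrite /= dvdn_mulr.
have sigma01 l : 0 <= sigma (M l) < 1.
  rewrite expR_ge0 -expR0 ltr_expR oppr_lt0 invr_gt0 mulr_gt0 // ltr0n M0 //.
have K_small l : 729 * (K (M l) ^+ 2 / (M l.+1)%:R) <= c0 / 4.
  have MR : 0 < (M l.+1)%:R :> R by rewrite ltr0n M0.
  rewrite mulrA ler_pdivrMr // [leRHS]mulrC -ler_pdivrMr ?divr_gt0 //.
  apply: le_trans (ltW (truncnS_gt _)) _; rewrite ler_nat /=.
  apply: leq_trans (leq_pmull _ (M0 l)); rewrite -!muln2 -!mulnA.
  by apply: leq_trans (leq_pmulr _ _).
have S_eps0 : 0 < c0 / 648.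
  by apply: divr_gt0; [exact: c00|rewrite ltr0n].
have /choice[eta eta_spec] : forall l, exists eta, 0 < eta /\
    forall n q (g : cube n -> R), lam <= q <= 1 - lam ->
    (forall y, 0 <= g y <= 1) ->
    (forall i, expect q (fun x => `|discrete_derivative i g x|) <= eta) ->
    \sum_i expect q (fun x => discrete_derivative i
       (noise q (fun=> sigma (M l)) (noise q (fun=> sigma (M l)) g)) x ^+ 4) <= c0 / 648.
  move=> l; have [eta eta0 H] := small_derivative_fourth_moment lam0 (sigma01 l) S_eps0.
  by exists eta.
(* The dimension is chosen last, to suit the finitely many levels at once. *)
pose eta_min := \big[Num.min/1]_(l < L) eta l.
have eta_min0 : 0 < eta_min.
  rewrite /eta_min; elim/big_ind: _ => //= [x y x0 y0|l _]; first by rewrite lt_min x0.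
  by have [] := eta_spec l.
pose m5 := (Num.truncn (lam ^+ 2 * eta_min ^+ 2)^-1).+1.
have [n NNn n_large] : exists2 n, NN n & (m1 + m2 + m3 + m4 + m5 + n1 <= n)%N.
  apply: contrapT => H; apply: NN_inf; apply: (sub_finite_set _ (finite_II (m1 + m2 + m3 + m4 + m5 + n1))).
  by move=> n NNn /=; rewrite ltnNge; apply/negP => h; apply: H; exists n.
have [[m1n m2n m3n] [m4n m5n n1n]] := le_of_sum _ _ _ _ _ _ _ n_large.
have n_ge1 := NN_ge1 n NNn.
have walk := X_walk n n_ge1.
have p_lam : lam <= p n <= 1 - lam.
  have h1 : c1 <= p n by rewrite -lee_fin; apply: pV1; exact: V1m.
  have h2 : p n <= 1 - c2 by rewrite -lee_fin; apply: pV2; exact: V2m.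
  rewrite (le_trans _ h1) ?ge_min ?lexx //=; apply: le_trans h2 _.
  by rewrite lerD2l lerN2 ge_min lexx orbT.
set q := expect (p n) (real_of_bool R (f n)).
have [_ qE] := initial_law lam0 p_lam walk (f n).
rewrite -/q in qE.
have q_v : v <= q <= 1 - v.
  have h1 : v1 <= q.
    by rewrite -lee_fin -qE; apply: qV3; exact: V3m.
  have h2 : q <= 1 - v2.
    by rewrite -lee_fin -qE; apply: qV4; exact: V4m.
  rewrite (le_trans _ h1) ?ge_min ?lexx //=; apply: le_trans h2 _.
  by rewrite lerD2l lerN2 ge_min lexx orbT.
have tight := f_tight n NNn n1n.
have tight_grid : (P n [set w | (k <= grid_changes (X n) (f n) w (M L))%N] <= eps%:E)%E.
  apply: le_trans (ltW tight).
  exact (grid_changes_le_num_changes lam0 p_lam walk (f n) k (M0 L)).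
have [l lL quiet] := exists_quiet_refinement lam0 p_lam walk M0 Mdvd (ltn0Sn _) tight_grid.
have small_deriv : forall i,
    expect (p n) (fun x => `|discrete_derivative i (real_of_bool R (f n)) x|) <= eta l.
  move=> i; apply: (@le_trans _ _ eta_min); last first.
    exact: (bigmin_le_cond _ _ (j := Ordinal lL)).
  apply: (regular_small_derivative lam0 p_lam walk (f_regular n NNn) (f_incr n NNn)) => //.
  have c5 : 0 < lam ^+ 2 * eta_min ^+ 2 by rewrite mulr_gt0 ?exprn_gt0.
  rewrite mulrAC -ler_pdivrMl // mulr1; apply: le_trans (ltW (truncnS_gt _)) _.
  by rewrite ler_nat.
have S_small := (eta_spec l).2 n (p n) _ p_lam (real_of_bool01 R (f n)) small_deriv.
have b_gt1 : (1 < b (M l))%N by [].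
have [r [rE]] := variance_le_refinement lam0 p_lam walk (f n) (M0 l) b_gt1.
rewrite -/(M l.+1) -/q -/(sigma (M l)) -/(K (M l)) in rE *.
have r_le : r <= eps + eps.
  rewrite -lee_fin -rE; apply: le_trans quiet _.
  by rewrite lee_fin lerD2r.
set S := \sum_i _ in S_small *.
have var_ge : c0 <= 2 * ((1 - expR (- 8^-1)) * lam ^+ 2 * (q - q ^+ 2)).
  rewrite /c0 ler_wpM2l // ler_wpM2l //.
    by rewrite mulr_ge0 ?sqr_ge0 // subr_ge0 -expR0 ler_expR oppr_le0 invr_ge0.
  have -> : q - q ^+ 2 = q * (1 - q) by ring.
  by case/andP: q_v => h1 h2; rewrite expr2 ler_pM ?(ltW v0) //; lra.
have := K_small l; rewrite /eps in r_le; lra.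
Qed.
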